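(* Let $\Gamma$ be an arbitrary finite graph without loops, and let $V=\bigoplus_{i\in I}V_i$, $W=\bigoplus_{i\in I}W_i$ be finite-dimensional complex $I$-graded spaces of dimension vectors $\mathbf v,\mathbf w$ with nondegenerate $\widetilde\delta_i$-symmetric forms on $V_i$ and $\delta_i$-symmetric forms on $W_i$, such that $\widetilde\delta_i\delta_i=-1$ for all $i\in I$ and $\widetilde\delta_{o(h)}\widetilde\delta_{i(h)}=-1$ for all arrows $h$. Then the morphism $$\iota:\ \Lambda(\mathbf v,\mathbf w)^\tau/\!/G^\tau_{\mathbf v}\longrightarrow\mathfrak M_0(\mathbf v,\mathbf w)^\tau$$ induced by the inclusion $\Lambda(\mathbf v,\mathbf w)^\tau\subseteq\Lambda(\mathbf v,\mathbf w)$ is a closed immersion.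
   Context: $I$ is the vertex set and $H$ the set of oriented edges of $\Gamma$ (source $o(h)$, target $i(h)$, reversal $h\mapsto\bar h$); $\varepsilon:H\to\{\pm1\}$ satisfies $\varepsilon(h)+\varepsilon(\bar h)=0$. A $\delta$-symmetric form ($\delta=\pm1$) satisfies $(e_1,e_2)=\delta(e_2,e_1)$. $\mathbf M(\mathbf v,\mathbf w)=\bigoplus_{h}\operatorname{Hom}(V_{o(h)},V_{i(h)})\oplus\bigoplus_i\big(\operatorname{Hom}(W_i,V_i)\oplus\operatorname{Hom}(V_i,W_i)\big)$ with elements $\mathbf x=(x_h,p_i,q_i)$; $\Lambda(\mathbf v,\mathbf w)=\{\mathbf x:\sum_{h:i(h)=i}\varepsilon(h)x_hx_{\bar h}-p_iq_i=0\ \forall i\}$. $G_{\mathbf v}=\prod_iGL(V_i)$ acts by $g\cdot\mathbf x=(g_{i(h)}x_hg_{o(h)}^{-1},g_ip_i,q_ig_i^{-1})$, and $\mathfrak M_0(\mathbf v,\mathbf w)=\Lambda(\mathbf v,\mathbf w)/\!/G_{\mathbf v}=\operatorname{Spec}\mathbb C[\Lambda(\mathbf v,\mathbf w)]^{G_{\mathbf v}}$. The right adjoint $T^*$ of a linear map is defined by $(Te,e')=(e,T^*e')$. $\tau$ is the automorphism $(x_h,p_i,q_i)\mapsto(\varepsilon(h)x_{\bar h}^*,-q_i^*,p_i^* )$ of $\mathbf M(\mathbf v,\mathbf w)$; it preserves $\Lambda(\mathbf v,\mathbf w)$ and induces an automorphism, also called $\tau$, of $\mathfrak M_0(\mathbf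 v,\mathbf w)$. A superscript $\tau$ on a variety means fixed points. $G^\tau_{\mathbf v}=\{g\in G_{\mathbf v}:g_ig_i^*=1\ \forall i\}$, and $/\!/$ denotes the categorical (affine GIT) quotient. *)

(* Defs.v *)
From HB Require Import structures.
From mathcomp Require Import all_boot all_order all_algebra.
From mathcomp Require Import all_classical reals.

Set Implicit Arguments.
Unset Strict Implicit.
Unset Printing Implicit Defensive.

Import GRing.Theory.
Local Open Scope classical_set_scope.
Local Open Scope ring_scope.

(* Affine varieties over an algebraically closed field K are handled through
   their closed points and their algebra of regular functions, a subalgebra of
   the K-valued functions on the set of points.  The record does not ask that
   points be the same as characters of the algebra; this holds for every
   variety that is built below. *)

Record subalgebra (K : fieldType) (T : Type) (A : set (T -> K)) : Prop := {
  subalgebraC : forall a, A (cst a);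
  subalgebraD : forall f g, A f -> A g -> A (f + g);
  subalgebraM : forall f g, A f -> A g -> A (f * g)
}.

Record affVar (K : closedFieldType) := AffVar {
  pt :> Type;
  reg : set (pt -> K);
  regP : subalgebra reg
}.
Arguments reg {K} X : rename.
Arguments AffVar {K pt} reg regP.

Record mor (K : closedFieldType) (X Y : affVar K) := Mor {
  mor_fun :> X -> Y;
  mor_reg : forall f : Y -> K, reg Y f -> reg X (f \o mor_fun)
}.

Section Varieties.
Variable K : closedFieldType.
Implicit Types X Y : affVar K.

Definition zclosed X (Z : set X) : Prop :=
  exists2 S : set (X -> K), S `<=` reg X &
    Z = [set x | forall f, S f -> f x = 0].

Definition sub_reg X (Z : set X) : set ({x : X | Z x} -> K) :=
  [set f | exists2 F, reg X F & f = F \o sval].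

Lemma sub_regP X (Z : set X) : subalgebra (@sub_reg X Z).
Proof.
split=> [a|f g [F rF ->] [G rG ->]|f g [F rF ->] [G rG ->]].
- by exists (cst a) => //; exact: subalgebraC (regP X) _.
- by exists (F + G) => //; exact: subalgebraD (regP X) _ _ rF rG.
- by exists (F * G) => //; exact: subalgebraM (regP X) _ _ rF rG.
Qed.

(* Meant for a Zariski closed Z, with its reduced structure: its regular
   functions are the restrictions of those of X. *)
Definition subVar X (Z : set X) : affVar K := AffVar _ (@sub_regP X Z).

Lemma incl_subproof X (Z : set X) f : reg X f -> reg (subVar Z) (f \o sval).
Proof. by exists f. Qed.

Definition incl_mor X (Z : set X) : mor (subVar Z) X := Mor (@incl_subproof X Z).

Lemma lift_subproof X Y (f : mor X Y) (Z : set Y) (fZ : forall x, Z (f x)) h :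
  reg (subVar Z) h -> reg X (h \o (fun x => exist Z (f x) (fZ x))).
Proof. by case=> F rF ->; exact: mor_reg f _ rF. Qed.

Definition lift_mor X Y (f : mor X Y) (Z : set Y) (fZ : forall x, Z (f x)) :
  mor X (subVar Z) := Mor (lift_subproof fZ).

Definition fixVar X (t : mor X X) : affVar K := subVar [set x | t x = x].

Definition isomorphism X Y (f : mor X Y) : Prop :=
  exists g : mor Y X, cancel f g /\ cancel g f.

(* f is an isomorphism onto a closed subvariety of Y *)
Definition closed_immersion X Y (f : mor X Y) : Prop :=
  exists2 Z : set Y, zclosed Z &
    exists2 g : mor X (subVar Z), isomorphism g & forall x, f x = sval (g x).

End Varieties.

Section Quotient.
Variables (K : closedFieldType) (X : affVar K) (G : Type) (act : G -> X -> X).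

(* act is only a family of maps; it is a group action in each use below *)
Definition invariant_fun : {pred X -> K} :=
  fun f => `[< reg X f /\ forall g x, f (act g x) = f x >].

Lemma invariantP f :
  reflect (reg X f /\ forall g x, f (act g x) = f x) (f \in invariant_fun).
Proof. exact: asboolP. Qed.

Lemma invariant_cst a : cst a \in invariant_fun.
Proof. by apply/invariantP; split=> //; exact: subalgebraC (regP X) a. Qed.

Lemma invariantD f g : f \in invariant_fun -> g \in invariant_fun -> f + g \in invariant_fun.
Proof.
move=> /invariantP[rf If] /invariantP[rg Ig]; apply/invariantP; split.
  exact: subalgebraD (regP X) _ _ rf rg.
by move=> u x; rewrite !fctE If Ig.
Qed.

Lemma invariantM f g : f \in invariant_fun -> g \in invariant_fun -> f * g \in invariant_fun.
Proof.
move=> /invariantP[rf If] /invariantP[rg Ig]; apply/invariantP; split.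
  exact: subalgebraM (regP X) _ _ rf rg.
by move=> u x; rewrite !fctE If Ig.
Qed.

Lemma invariant_subring : subring_closed invariant_fun.
Proof.
split=> [|f g If Ig|]; [exact: invariant_cst 1| |exact: invariantM].
by rewrite -mulN1r invariantD// invariantM// (invariant_cst (-1)).
Qed.

(* K[X]^G *)
Record invRing := InvRing { inv_fun :> X -> K; inv_funP : inv_fun \in invariant_fun }.

HB.instance Definition _ := [isSub for inv_fun].
HB.instance Definition _ := [Choice of invRing by <:].
HB.instance Definition _ :=
  GRing.SubChoice_isSubComPzRing.Build _ _ invRing invariant_subring.

Definition inv_cst a : invRing := InvRing (invariant_cst a).

(* A closed point of Spec K[X]^G is a K-algebra homomorphism K[X]^G -> K. *)
Record quotPt := QuotPt {
  quot_ev :> {rmorphism invRing -> K};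
  quot_evC : forall a, quot_ev (inv_cst a) = a
}.

Definition quot_reg : set (quotPt -> K) :=
  [set F | exists f : invRing, F = fun c : quotPt => c f].

Lemma quot_regP : subalgebra quot_reg.
Proof.
split=> [a|_ _ [f ->] [g ->]|_ _ [f ->] [g ->]].
- by exists (inv_cst a); apply/funext => c; rewrite quot_evC.
- by exists (f + g); apply/funext => c; rewrite rmorphD.
- by exists (f * g); apply/funext => c; rewrite rmorphM.
Qed.

Definition quotVar : affVar K := AffVar _ quot_regP.

End Quotient.

Section QuotientMorphism.
Variables (K : closedFieldType) (X Y : affVar K) (G H : Type).
Variables (aX : G -> X -> X) (aY : H -> Y -> Y) (f : mor X Y).
Hypothesis f_orbit : forall g x, exists h, f (aX g x) = aY h (f x).

Lemma inv_pullback_subproof (u : invRing aY) : (u : Y -> K) \o f \in invariant_fun aX.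
Proof.
have /invariantP[ru Iu] := inv_funP u; apply/invariantP; split.
  exact: mor_reg f _ ru.
by move=> g x /=; have [h ->] := f_orbit g x; rewrite Iu.
Qed.

Definition inv_pullback (u : invRing aY) : invRing aX :=
  InvRing (inv_pullback_subproof u).

Lemma inv_pullback_zmod : zmod_morphism inv_pullback.
Proof. by move=> u v; exact/val_inj. Qed.

Lemma inv_pullback_monoid : monoid_morphism inv_pullback.
Proof. by split=> [|u v]; exact/val_inj. Qed.

HB.instance Definition _ := GRing.isZmodMorphism.Build _ _ _ inv_pullback_zmod.
HB.instance Definition _ := GRing.isMonoidMorphism.Build _ _ _ inv_pullback_monoid.

Lemma quot_pt_subproof (c : quotPt aX) a : (c \o inv_pullback) (inv_cst aY a) = a.
Proof. by rewrite -[RHS](quot_evC c); congr (c _); exact/val_inj. Qed.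

Definition quot_pt (c : quotVar aX) : quotVar aY := QuotPt (quot_pt_subproof c).

Lemma quot_pt_reg F : reg (quotVar aY) F -> reg (quotVar aX) (F \o quot_pt).
Proof. by case=> u ->; exists (inv_pullback u). Qed.

Definition quot_mor : mor (quotVar aX) (quotVar aY) := Mor quot_pt_reg.

End QuotientMorphism.

Lemma quotPt_eq (K : closedFieldType) (X : affVar K) G (act : G -> X -> X)
  (c d : quotPt act) : c =1 d -> c = d.
Proof.
case: c d => [[c c_rmorph] cC] [[d d_rmorph] dC] /= cd.
have {}cd : c = d by exact/funext.
subst d.
case: c_rmorph cC => [[[c1 c2]] [[c3 c4]]] cC.
case: d_rmorph dC => [[[d1 d2]] [[d3 d4]]] dC.
move: d1 d2 d3 d4 dC => d1 d2 d3 d4.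
rewrite (Prop_irrelevance d1 c1) (Prop_irrelevance d2 c2).
rewrite (Prop_irrelevance d3 c3) (Prop_irrelevance d4 c4) => dC.
by rewrite (Prop_irrelevance dC cC).
Qed.

(* A finite graph as a family of finite sets of oriented edges: for h in
   edge i j the source of h is i and its target is j.  This way, the reversal
   swaps the two indices definitionally. *)
Record graph := Graph {
  vertex : finType;
  edge : vertex -> vertex -> finType;
  erev : forall i j, edge i j -> edge j i;
  erevK : forall i j (h : edge i j), erev (erev h) = h;
  no_loop : forall i, edge i i -> False
}.
Arguments erev {g i j} h.

Record edge_sign (K : fieldType) (Gm : graph) := EdgeSign {
  sgn : forall i j : vertex Gm, edge i j -> K;
  sgnP : forall i j (h : edge i j), sgn h = 1 \/ sgn h = -1;
  sgn_rev : forall i j (h : edge i j), sgn h + sgn (erev h) = 0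
}.
Arguments sgn {K Gm} e {i j} h.

Section Adjoint.
Variables (K : fieldType) (U U' : vectType K).

(* The T^* with (T e, e')_{U'} = (e, T^* e')_U; see adjointP and adjoint_uniq
   for its existence and uniqueness when b is nondegenerate. *)
Definition adjoint (b : U -> U -> K) (b' : U' -> U' -> K) (T : 'Hom(U, U')) :
    'Hom(U', U) :=
  xget 0 [set S : 'Hom(U', U) | forall e e', b' (T e) e' = b e (S e')].

End Adjoint.

Section AdjointTheory.
Variable K : fieldType.

Lemma formPl (U : vectType K) e (b : {hermitian U for e & idfun}) a u v w :
  b (a *: u + v) w = a * b u w + b v w.
Proof. by rewrite linearDl linearZl_LR. Qed.

Lemma formPr (U : vectType K) e (b : {hermitian U for e & idfun}) a u v w :
  b w (a *: u + v) = a * b w u + b w v.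
Proof. by rewrite linearPr. Qed.

Lemma nondeg_inj (U : vectType K) e (b : {hermitian U for e & idfun}) :
  nondegenerate b -> forall y, (forall x, b x y = 0) -> y = 0.
Proof.
move=> /eqP nb y y0; apply/eqP; rewrite -memv0 -nb; apply/mem_orthovP => v _.
by rewrite hermC y0 /= mulr0.
Qed.

Lemma scalar_eq (U : vectType K) (l1 l2 : U -> K) : scalar l1 -> scalar l2 ->
  (forall i : 'I_(\dim {:U}), l1 (vbasis {:U})`_i = l2 (vbasis {:U})`_i) ->
  l1 =1 l2.
Proof.
move=> s1 s2 E x.
pose L1 : {scalar U} := HB.pack l1 (GRing.isLinear.Build _ _ _ _ l1 s1).
pose L2 : {scalar U} := HB.pack l2 (GRing.isLinear.Build _ _ _ _ l2 s2).
rewrite (coord_vbasis (memvf x)) -[l1]/(L1 : U -> K) -[l2]/(L2 : U -> K).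
rewrite !linear_sum; apply: eq_bigr => i _.
by rewrite !linearZ; congr (_ * _); exact: E.
Qed.

Lemma riesz (U : vectType K) e (b : {hermitian U for e & idfun}) (l : U -> K) :
  nondegenerate b -> scalar l -> exists y, forall x, l x = b x y.
Proof.
move=> nb lin_l; pose n := \dim {:U}; pose B := vbasis {:U}.
have bl y : scalar (b ^~ y).
  by move=> a u v; rewrite formPl.
pose phi y : 'rV[K]_n := \row_i b B`_i y.
have phi_lin : linear phi.
  by move=> a u v; apply/rowP => i; rewrite !mxE formPr.
pose Phi : {linear U -> 'rV[K]_n} :=
  HB.pack phi (GRing.isLinear.Build _ _ _ _ phi phi_lin).
pose F := linfun Phi.
have kF : lker F == 0%VS.
  apply/lker0P; move=> u v; rewrite !lfunE /= => /rowP Euv.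
  apply/eqP; rewrite -subr_eq0; apply/eqP; apply: (nondeg_inj nb) => x.
  rewrite linearBr; apply/eqP; rewrite subr_eq0; apply/eqP; move: x.
  by apply: scalar_eq (bl _) (bl _) _ => i; have := Euv i; rewrite !mxE.
have imF : (limg F = {: 'rV[K]_n})%VS.
  apply/eqP; rewrite eqEdim subvf /= limg_dim_eq; last by rewrite (eqP kF) capv0.
  by rewrite /n !dimvf /dim /= mul1n.
have : (\row_i l B`_i : 'rV[K]_n) \in limg F by rewrite imF memvf.
case/memv_imgP => y _; rewrite lfunE /= => /rowP Ey; exists y.
by apply: scalar_eq lin_l (bl y) _ => i; have := Ey i; rewrite !mxE.
Qed.

Variables (U U' : vectType K) (e e' : bool).
Variables (b : {hermitian U for e & idfun}) (b' : {hermitian U' for e' & idfun}).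
Hypothesis nb : nondegenerate b.

Lemma nondeg_injr y z : (forall x, b x y = b x z) -> y = z.
Proof.
move=> E; apply/eqP; rewrite -subr_eq0; apply/eqP; apply: (nondeg_inj nb) => x.
by rewrite linearBr; apply/eqP; rewrite subr_eq0; apply/eqP; exact: E.
Qed.

Lemma adjointP (T : 'Hom(U, U')) x y : b' (T x) y = b x (adjoint b b' T y).
Proof.
rewrite /adjoint.
pose A : set 'Hom(U', U) := [set S | forall x y, b' (T x) y = b x (S y)].
suff [S AS] : exists S, A S by have /= -> := @xgetPex _ 0 A (ex_intro _ S AS).
have ex w : exists z, forall x, b' (T x) w = b x z.
  apply: (@riesz U e b (fun x => b' (T x) w) nb).
  by move=> a u v; rewrite linearP formPl.
have [s Hs] := choice ex.
have s_lin : linear s.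
  by move=> a u v; apply: nondeg_injr => z; rewrite formPr -!Hs formPr.
pose S : {linear U' -> U} := HB.pack s (GRing.isLinear.Build _ _ _ _ s s_lin).
by exists (linfun S) => z w; rewrite lfunE /= Hs.
Qed.

Lemma adjoint_uniq (T : 'Hom(U, U')) (S : 'Hom(U', U)) :
  (forall x y, b' (T x) y = b x (S y)) -> adjoint b b' T = S.
Proof.
by move=> H; apply/lfunP => y; apply: nondeg_injr => x; rewrite -adjointP H.
Qed.

Lemma adjoint_lin : linear (adjoint b b').
Proof.
move=> a S T; apply: adjoint_uniq => x y.
by rewrite !add_lfunE !scale_lfunE formPr -!adjointP formPl.
Qed.

Lemma adjointD S T : adjoint b b' (S + T) = adjoint b b' S + adjoint b b' T.
Proof. by have := adjoint_lin 1 S T; rewrite !scale1r. Qed.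

Lemma adjoint0 : adjoint b b' 0 = 0.
Proof. by have := adjoint_lin (-1) 0 0; rewrite !scaleN1r !addNr. Qed.

Lemma adjointZ a S : adjoint b b' (a *: S) = a *: adjoint b b' S.
Proof. by have := adjoint_lin a S 0; rewrite adjoint0 !addr0. Qed.

Lemma adjointN S : adjoint b b' (- S) = - adjoint b b' S.
Proof. by rewrite -[- S]scaleN1r adjointZ scaleN1r. Qed.

Lemma adjoint_sum I (r : seq I) (P : pred I) F :
  adjoint b b' (\sum_(i <- r | P i) F i) = \sum_(i <- r | P i) adjoint b b' (F i).
Proof. exact: (big_morph _ adjointD adjoint0). Qed.

End AdjointTheory.

Lemma adjoint_comp (K : fieldType) (U1 U2 U3 : vectType K) (e1 e2 e3 : bool)
  (b1 : {hermitian U1 for e1 & idfun}) (b2 : {hermitian U2 for e2 & idfun})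
  (b3 : {hermitian U3 for e3 & idfun}) (S : 'Hom(U2, U3)) (T : 'Hom(U1, U2)) :
  nondegenerate b1 -> nondegenerate b2 ->
  adjoint b1 b3 (S \o T)%VF = (adjoint b1 b2 T \o adjoint b2 b3 S)%VF.
Proof.
move=> n1 n2; apply: adjoint_uniq => // x y.
by rewrite !comp_lfunE (adjointP b3 n2) (adjointP b2 n1).
Qed.

Lemma adjoint1 (K : fieldType) (U : vectType K) (e : bool)
  (b : {hermitian U for e & idfun}) : nondegenerate b -> adjoint b b \1%VF = \1%VF.
Proof. by move=> n1; apply: adjoint_uniq => // x y; rewrite !id_lfunE. Qed.

Section CompSum.
Variables (K : fieldType) (U1 U2 U3 : vectType K) (I : Type) (r : seq I).
Variable P : pred I.

Lemma comp_lfun_suml (F : I -> 'Hom(U2, U3)) (T : 'Hom(U1, U2)) :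
  ((\sum_(i <- r | P i) F i) \o T)%VF = \sum_(i <- r | P i) (F i \o T)%VF.
Proof.
apply: (big_morph (fun S => S \o T)%VF) => [S S'|]; first exact: comp_lfunDl.
exact: comp_lfun0l.
Qed.

Lemma comp_lfun_sumr (S : 'Hom(U2, U3)) (F : I -> 'Hom(U1, U2)) :
  (S \o (\sum_(i <- r | P i) F i))%VF = \sum_(i <- r | P i) (S \o F i)%VF.
Proof.
apply: (big_morph (fun T => S \o T)%VF) => [T T'|]; first exact: comp_lfunDr.
exact: comp_lfun0r.
Qed.

End CompSum.

Section Representations.
Variables (K : closedFieldType) (Gm : graph) (V W : vertex Gm -> vectType K).
Implicit Types i j : vertex Gm.

(* The points of M(v, w).  The dimension vectors v and w are those of V and W. *)
Record rep := Rep {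
  rx : forall i j, edge i j -> 'Hom(V i, V j);
  rp : forall i, 'Hom(W i, V i);
  rq : forall i, 'Hom(V i, W i)
}.

Lemma rep_eq (x y : rep) : (forall i j (h : edge i j), rx x h = rx y h) ->
  (forall i, rp x i = rp y i) -> (forall i, rq x i = rq y i) -> x = y.
Proof.
case: x y => [x p q] [x' p' q'] /= Ex Ep Eq; congr Rep; last 2 first.
- exact/functional_extensionality_dep.
- exact/functional_extensionality_dep.
apply/functional_extensionality_dep => i; apply/functional_extensionality_dep => j.
exact/functional_extensionality_dep.
Qed.

(* The polynomial functions on the vector space M(v, w) *)
Inductive poly_rep : set (rep -> K) :=
| poly_cst a : poly_rep (cst a)
| poly_x i j (h : edge i j) (l : 'Hom(V i, V j) -> K) :
    scalar l -> poly_rep (fun x => l (rx x h))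
| poly_p i (l : 'Hom(W i, V i) -> K) : scalar l -> poly_rep (fun x => l (rp x i))
| poly_q i (l : 'Hom(V i, W i) -> K) : scalar l -> poly_rep (fun x => l (rq x i))
| poly_add f g : poly_rep f -> poly_rep g -> poly_rep (f + g)
| poly_mul f g : poly_rep f -> poly_rep g -> poly_rep (f * g).

Lemma poly_rep_subproof : subalgebra poly_rep.
Proof. by split; [exact: poly_cst | exact: poly_add | exact: poly_mul]. Qed.

Definition repVar : affVar K := AffVar _ poly_rep_subproof.

(* G_v *)
Definition GLv := {g : forall i, 'End(V i) | forall i, lker (g i) == 0%VS}.

Definition rep_act (g : GLv) (x : rep) : rep :=
  Rep (fun i j h => sval g j \o rx x h \o (sval g i)^-1)%VF
      (fun i => sval g i \o rp x i)%VF
      (fun i => rq x i \o (sval g i)^-1)%VF.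

Variable eps : edge_sign K Gm.

Definition moment (x : rep) i : 'End(V i) :=
  \sum_j \sum_(h : edge j i) sgn eps h *: (rx x h \o rx x (erev h))%VF
  - (rp x i \o rq x i)%VF.

Definition LambdaVar : affVar K := subVar (X := repVar) [set x | forall i, moment x i = 0].

Lemma moment_act g x i :
  moment (rep_act g x) i = (sval g i \o moment x i \o (sval g i)^-1)%VF.
Proof.
rewrite /moment comp_lfunDr comp_lfunDl comp_lfunNr comp_lfunNl; congr (_ - _).
  rewrite comp_lfun_sumr comp_lfun_suml; apply: eq_bigr => j _.
  rewrite comp_lfun_sumr comp_lfun_suml; apply: eq_bigr => h _ /=.
  rewrite -comp_lfunZr -comp_lfunZl; congr (_ *: _).
  by rewrite !comp_lfunA lker0_compfVK ?(svalP g)// -!comp_lfunA.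
by rewrite /= !comp_lfunA.
Qed.

Lemma sval_inj T (P : T -> Prop) (x y : {u | P u}) : sval x = sval y -> x = y.
Proof. by case: x y => x Px [y Py] /= E; exact: eq_exist. Qed.

Lemma Lambda_act_subproof (g : GLv) (x : LambdaVar) i :
  moment (rep_act g (sval x)) i = 0.
Proof. by rewrite moment_act (svalP x i) comp_lfun0r comp_lfun0l. Qed.

Definition Lambda_act (g : GLv) (x : LambdaVar) : LambdaVar :=
  exist _ (rep_act g (sval x)) (Lambda_act_subproof g x).

(* M_0(v, w) *)
Definition M0 : affVar K := quotVar Lambda_act.

(* A delta-symmetric form with delta = (-1)^d is a hermitian form for the sign
   bit d and the identity: (x, y) = (-1)^d (y, x). *)
Variables (dV dW : vertex Gm -> bool).
Variable fV : forall i, {hermitian (V i) for dV i & idfun}.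
Variable fW : forall i, {hermitian (W i) for dW i & idfun}.

Definition tau_rep (x : rep) : rep :=
  Rep (fun i j h => sgn eps h *: adjoint (fV j) (fV i) (rx x (erev h)))
      (fun i => - adjoint (fV i) (fW i) (rq x i))
      (fun i => adjoint (fW i) (fV i) (rp x i)).

(* G_v^tau *)
Definition GLv_tau :=
  {g : GLv | forall i,
     (sval g i \o adjoint (fV i) (fV i) (sval g i) = \1)%VF}.

Hypothesis ndV : forall i, nondegenerate (fV i).
Hypothesis ndW : forall i, nondegenerate (fW i).

Lemma moment_tau x i : moment (tau_rep x) i = - adjoint (fV i) (fV i) (moment x i).
Proof.
rewrite /moment adjointD // opprD adjointN // opprK.
rewrite (adjoint_comp (b2 := fW i)) //=; congr (_ + _); last by rewrite comp_lfunNl opprK.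
rewrite adjoint_sum // -sumrN; apply: eq_bigr => j _.
rewrite adjoint_sum // -sumrN; apply: eq_bigr => h _.
rewrite erevK adjointZ // (adjoint_comp (b2 := fV j)) // -comp_lfunZl -comp_lfunZr !scalerA.
rewrite -scaleNr; congr (_ *: _).
have -> : sgn eps (erev h) = - sgn eps h.
  by apply/eqP; rewrite -addr_eq0 addrC sgn_rev.
by case: (sgnP eps h) => ->; rewrite ?mulN1r ?mul1r ?opprK ?mulr1.
Qed.

Lemma tau_rep_reg f : reg repVar f -> reg repVar (f \o tau_rep).
Proof.
elim=> [a|i j h l l_lin|i l l_lin|i l l_lin|g k _ IHg _ IHk|g k _ IHg _ IHk].
- exact: poly_cst.
- have H : scalar (fun y => l (sgn eps h *: adjoint (fV j) (fV i) y)).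
    move=> a u v; rewrite adjoint_lin // scalerDr scalerA mulrC -scalerA.
    exact: l_lin.
  exact: (poly_x (erev h) H).
- have H : scalar (fun y => l (- adjoint (fV i) (fW i) y)).
    by move=> a u v; rewrite adjoint_lin // opprD -scalerN; exact: l_lin.
  exact: (poly_q H).
- have H : scalar (fun y => l (adjoint (fW i) (fV i) y)).
    by move=> a u v; rewrite adjoint_lin //; exact: l_lin.
  exact: (poly_p H).
- exact: poly_add.
- exact: poly_mul.
Qed.

Lemma tau_subproof (x : LambdaVar) i : moment (tau_rep (sval x)) i = 0.
Proof. by rewrite moment_tau (svalP x i) adjoint0 // oppr0. Qed.

Lemma tau_reg f : reg LambdaVar f ->
  reg LambdaVar (f \o (fun x => exist _ (tau_rep (sval x)) (tau_subproof x))).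
Proof.
by case=> F rF ->; exists (F \o tau_rep) => //; exact: tau_rep_reg.
Qed.

Definition tau : mor LambdaVar LambdaVar := Mor tau_reg.

Definition LambdaTau : affVar K := fixVar tau.

Lemma adjointV_lker (g : GLv) i :
  lker (adjoint (fV i) (fV i) (sval g i)^-1%VF) == 0%VS.
Proof.
apply/lker0P; apply: (can_inj (g := adjoint (fV i) (fV i) (sval g i))) => u.
by rewrite -comp_lfunE -(adjoint_comp (b2 := fV i)) // lker0_compVf ?(svalP g) // adjoint1 // id_lfunE.
Qed.

(* tau (g x) = (g^* )^-1 (tau x) *)
Definition GLv_dual (g : GLv) : GLv :=
  exist _ (fun i => adjoint (fV i) (fV i) (sval g i)^-1%VF) (adjointV_lker g).

Lemma inv_lfunE (U : vectType K) (f g : 'End(U)) :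
  lker f == 0%VS -> (f \o g = \1)%VF -> (f^-1)%VF = g.
Proof. by move=> kf fg; rewrite -[LHS]comp_lfun1r -fg lker0_compKf. Qed.

Lemma GLv_dualV g i :
  ((sval (GLv_dual g) i)^-1)%VF = adjoint (fV i) (fV i) (sval g i).
Proof.
apply: inv_lfunE; first exact: svalP (GLv_dual g) i.
by rewrite /= -adjoint_comp // lker0_compfV ?(svalP g) // adjoint1.
Qed.

Lemma tau_act g x : tau_rep (rep_act g x) = rep_act (GLv_dual g) (tau_rep x).
Proof.
apply: rep_eq => [i j h|i|i] /=.
- rewrite GLv_dualV (adjoint_comp (b2 := fV j)) // (adjoint_comp (b2 := fV i)) //.
 by rewrite -comp_lfunZr -comp_lfunZl comp_lfunA.
- by rewrite (adjoint_comp (b2 := fV i)) // comp_lfunNr.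
- by rewrite GLv_dualV (adjoint_comp (b2 := fV i)).
Qed.

Lemma GLv_tau_dual (g : GLv_tau) i : sval (GLv_dual (sval g)) i = sval (sval g) i.
Proof.
have H := svalP g i; have k := svalP (sval g) i.
have E : (adjoint (fV i) (fV i) (sval (sval g) i) \o sval (sval g) i = \1)%VF.
  by rewrite -(inv_lfunE k H) lker0_compVf.
rewrite -[LHS]comp_lfun1r -E -GLv_dualV comp_lfunA lker0_compfV ?comp_lfun1l //.
exact: svalP (GLv_dual (sval g)) i.
Qed.

Lemma tau_orbit g (x : LambdaVar) :
  exists g', tau (Lambda_act g x) = Lambda_act g' (tau x).
Proof. by exists (GLv_dual g); apply: sval_inj; exact: tau_act. Qed.

(* The automorphism of M_0(v, w) induced by tau *)
Definition tau_M0 : mor M0 M0 := quot_mor tau_orbit.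

Definition M0_tau : affVar K := fixVar tau_M0.

Lemma LambdaTau_act_subproof (g : GLv_tau) (x : LambdaTau) :
  tau (Lambda_act (sval g) (sval x)) = Lambda_act (sval g) (sval x).
Proof.
apply: sval_inj => /=; rewrite tau_act.
have /= -> : tau_rep (sval (sval x)) = sval (sval x).
  by have /(congr1 sval) := svalP x.
have E i : adjoint (fV i) (fV i) (sval (sval g) i)^-1%VF = sval (sval g) i.
  exact: GLv_tau_dual.
by apply: rep_eq => [i j h|i|i] /=; rewrite !E.
Qed.

Definition LambdaTau_act (g : GLv_tau) (x : LambdaTau) : LambdaTau :=
  exist _ (Lambda_act (sval g) (sval x)) (LambdaTau_act_subproof g x).

Lemma incl_orbit (g : GLv_tau) (x : LambdaTau) :
  exists g', incl_mor _ (LambdaTau_act g x) = Lambda_act g' (incl_mor _ x).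
Proof. by exists (sval g). Qed.

(* Lambda(v, w)^tau // G_v^tau *)
Definition LambdaTau_quot : affVar K := quotVar LambdaTau_act.

Definition iota_M0 : mor LambdaTau_quot M0 := quot_mor incl_orbit.

Lemma iota_fix (c : LambdaTau_quot) : tau_M0 (iota_M0 c) = iota_M0 c.
Proof.
apply: quotPt_eq => u /=; congr (quot_ev c _); apply/val_inj/funext => x /=.
by have /= -> := svalP x.
Qed.

Definition iota_tau : mor LambdaTau_quot M0_tau := lift_mor iota_fix.

End Representations.

(* Main.v *)
(* Points of a quotient are characters, so it is enough that every [G_v^tau]-invariant
   function on [Lambda^tau] is the restriction of a [G_v]-invariant function on [Lambda].

   Adding a vertex [None] with space [K] and trivial group, every coordinate of a
   representation becomes a matrix entry of an operator between the spaces [V_i].  In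
   bases where the forms are monomial, a regular function on [Lambda^tau] is the value of
   a tensor [t] on words in the bilinear forms attached to these operators.  Let [U] be the
   space of tensors whose value extends to a [G_v]-invariant function.  Subtract from [t]
   its projection on [U] for the standard Hermitian product.  The isometry Lie algebra
   is stable under conjugate transposition, so the difference [r], orthogonal to [U], is
   itself invariant: every Lie derivative of [r] has value zero, and it is orthogonal to the
   tensors of value zero, so it vanishes.

   A complete contraction of a word in the letters is a product of traces of closed paths,
   because on the fixed locus of [tau] the transpose of a letter is again a letter up to
   sign.  Hence all complete contractions of [r] vanish, and by induction all contractions
   do.  Finally a traceless tensor, invariant under the orthogonal or symplectic Lie
   algebra and under the reflections in the basis vectors, is zero: contracting the
   invariance equation with one slot gives [(n - delta) t + sum_b (a b) t = 0]. *)

From HB Require Import structures.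
Require Import Defs.
From mathcomp Require Import all_boot all_order all_algebra all_fingroup.
From mathcomp Require Import ring zify boolp.

Set Implicit Arguments.
Unset Strict Implicit.
Unset Printing Implicit Defensive.

Import GRing.Theory Num.Theory.
Local Open Scope ring_scope.

(** * Eigenfunctions of slot transpositions *)

Section Swap.
Variables (K : numFieldType) (A E : finType).
Implicit Types (e : {ffun A -> E}) (s : {perm A}) (phi : {ffun A -> E} -> K).

Definition reslot e s : {ffun A -> E} := [ffun a => e (s a)].

Lemma reslotM e s t : reslot (reslot e s) t = reslot e (t * s)%g.
Proof. by apply/ffunP => a; rewrite !ffunE permM. Qed.

Lemma reslot_tpermK e a b : reslot (reslot e (tperm a b)) (tperm a b) = e.
Proof. by rewrite reslotM tperm2; apply/ffunP => c; rewrite ffunE perm1. Qed.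

Lemma reslot_tpermJ e s a b :
  reslot (reslot e (tperm (s a) (s b))) s = reslot (reslot e s) (tperm a b).
Proof. by rewrite !reslotM -tpermJ conjgE !mulgA mulgV mul1g. Qed.

Variables (D : {set A}) (F : {set E}) (d : bool) (Q : {ffun A -> E} -> Prop).
Hypothesis QF : forall e a, Q e -> a \in D -> e a \in F.
Hypothesis Qswap : forall e a b, Q e -> a \in D -> b \in D -> Q (reslot e (tperm a b)).

(** For every slot [a] of [D], the sum of the transpositions through [a] acts by the scalar
    [delta - n], with [n = #|F|] and [delta = (-1) ^+ d]. In the application [Q] fixes which slots
    carry indices of the block [F], so that blocks are treated one at a time. *)
Definition swap_eigen phi := forall e a, Q e -> a \in D ->
  (#|F|%:R - (-1) ^+ d) * phi e + \sum_(b in D | b != a) phi (reslot e (tperm a b)) = 0.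

(** The effect of invariance under the reflections in basis vectors, for a symmetric form. It
    excludes determinant-like tensors, which are invariant under the special orthogonal group but
    not under the orthogonal one. *)
Definition even_support phi := ~~ d -> forall e p, Q e -> p \in F ->
  odd #|[set a in D | e a == p]| -> phi e = 0.

Definition alternating (T : {set A}) phi := forall e a b, Q e -> a \in T -> b \in T ->
  a != b -> phi (reslot e (tperm a b)) = - phi e.

Lemma tperm_stable a b c : a \in D -> b \in D -> (tperm a b c \in D) = (c \in D).
Proof. by case: tpermP => [->|->|//] -> ->. Qed.

Lemma swap_eigen_reslot phi a b : a \in D -> b \in D -> swap_eigen phi ->
  swap_eigen (fun e => phi (reslot e (tperm a b))).
Proof.
move=> Da Db Pphi e c Qe Dc; set s := tperm a b.
have sD x : (s x \in D) = (x \in D) by exact: tperm_stable.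
rewrite -[RHS](Pphi (reslot e s) (s c) (Qswap Qe Da Db)) ?sD //; congr (_ + _).
rewrite [RHS](reindex_inj (@perm_inj _ s)) /=; apply: eq_big => [x|x _].
  by rewrite sD (inj_eq perm_inj).
by rewrite -reslot_tpermJ !tpermK.
Qed.

Lemma even_support_reslot phi a b : a \in D -> b \in D -> even_support phi ->
  even_support (fun e => phi (reslot e (tperm a b))).
Proof.
move=> Da Db Pphi d0 e p Qe Fp op; apply: (Pphi d0 _ p) => //; first exact: Qswap.
rewrite -(card_imset _ (@perm_inj _ (tperm a b))); move: op; congr (odd #|pred_of_set _|).
apply/setP => c; rewrite -[c in RHS](tpermK a b) (mem_imset _ _ perm_inj) !inE ffunE tpermK.
by rewrite tperm_stable.
Qed.

(** The identity and the swaps of [b] with the slots of [T] represent the cosets of the permutations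
    of [T] in those of [b |: T]. A swap of [c] and [b] exchanges the identity term with the term of
    [c], and changes each other term by a swap inside [T], hence by a sign. *)
Lemma alternatingU1 phi (T : {set A}) b : T \subset D -> b \in D -> b \notin T ->
  alternating T phi ->
  alternating (b |: T) (fun e => phi e - \sum_(a in T) phi (reslot e (tperm a b))).
Proof.
move=> TD Db nTb altT.
have main e c : Q e -> c \in T ->
    phi (reslot e (tperm c b)) - \sum_(a in T) phi (reslot (reslot e (tperm c b)) (tperm a b))
    = - (phi e - \sum_(a in T) phi (reslot e (tperm a b))).
  move=> Qe Tc; have cb : c != b by apply: contraNneq nTb => <-.
  rewrite (bigD1 c) //= reslot_tpermK [in RHS](bigD1 c) //=.
  rewrite (_ : \sum_(a in T | a != c) _ = - \sum_(a in T | a != c) phi (reslot e (tperm a b))).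
    by rewrite !opprD !opprK addrCA addrA.
  rewrite -sumrN; apply: eq_bigr => a /andP[Ta ac].
  have ab : a != b by apply: contraNneq nTb => <-.
  have nca : c != a by rewrite eq_sym.
  have Q1 : Q (reslot e (tperm a b)) by exact: Qswap Qe (subsetP TD _ Ta) Db.
  rewrite -(altT _ _ _ Q1 Tc Ta nca).
  by rewrite -(reslot_tpermJ e (tperm a b) c a) tpermL tpermD // eq_sym.
move=> e a c Qe; rewrite !inE => /predU1P[->|Ta] /predU1P[->|Tc]; rewrite ?eqxx // => ac.
- by rewrite tpermC; exact: main.
- exact: main.
rewrite altT // opprB addrC; congr (_ - _).
rewrite -sumrN (reindex_inj (@perm_inj _ (tperm a c))) /=.
have sT x : (tperm a c x \in T) = (x \in T) by case: tpermP => [->|->|//]; rewrite Ta Tc.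
apply: eq_big => [x|x Tx]; first by rewrite sT.
have nTs : tperm a c b = b.
  by rewrite tpermD //; apply: contraNneq nTb => <-.
rewrite sT in Tx.
have Q1 : Q (reslot e (tperm x b)).
  by apply: Qswap => //; exact: (subsetP TD).
by rewrite -(reslot_tpermJ e (tperm a c) (tperm a c x) b) tpermK nTs altT ?opprK.
Qed.

Lemma alternating_inj phi (T : {set A}) e : Q e -> alternating T phi -> phi e != 0 ->
  {in T &, injective e}.
Proof.
move=> Qe altT nz a b Ta Tb Eab; apply/eqP; apply: contraNT nz => ab.
have := altT e a b Qe Ta Tb ab.
rewrite (_ : reslot e _ = e); last first.
  by apply/ffunP => c; rewrite ffunE; case: tpermP => // ->.
by move/eqP; rewrite -addr_eq0 -mulr2n mulrn_eq0.
Qed.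

(* If [phi] alternates on [T], adding a slot [b] to [T] by antisymmetrisation gives a
   function that vanishes by induction, i.e. the swaps of [b] with the slots of [T] sum to
   the identity.  Summing the eigenvalue equations over [T] then gives
   [k (n - delta - k + 1) + (m - k) = 0] with [k = #|T| <= n = #|F|] and [m = #|D|]. *)
Lemma swap_eigen_alternating_eq0 phi (T : {set A}) : D != set0 ->
  T \subset D -> swap_eigen phi -> even_support phi -> alternating T phi ->
  forall e, Q e -> phi e = 0.
Proof.
move=> D0; have [n] := ubnP (#|D| - #|T|); elim: n => // n IHn in T phi *.
move=> ltn TD eigphi evphi altT e Qe; apply/eqP; apply/negPn/negP => nz.
have swapb b : b \in D -> b \notin T -> \sum_(a in T) phi (reslot e (tperm a b)) = phi e.
  move=> Db nTb; apply/eqP; rewrite eq_sym -subr_eq0; apply/eqP; move: e Qe {nz}.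
  have bTD : b |: T \subset D by rewrite subUset sub1set Db.
  apply: (IHn (b |: T)) => //; last exact: alternatingU1.
  - have := subset_leq_card bTD; rewrite cardsU1 nTb /=; lia.
  - move=> e a Qe Da /=; rewrite sumrB exchange_big /= mulrBr addrACA eigphi // add0r.
    rewrite mulr_sumr -opprD -big_split big1 ?oppr0 // => c Tc /=.
    exact: (swap_eigen_reslot (subsetP TD _ Tc) Db eigphi).
  - move=> d0 e p Qe Fp op; rewrite (evphi _ _ p) // big1 ?subr0 // => c Tc.
    exact: (even_support_reslot (subsetP TD _ Tc) Db evphi d0 Qe Fp op).
have kn : (#|T| <= #|F|)%N.
  have eI := alternating_inj Qe altT nz; rewrite -(card_in_imset eI).
  apply/subset_leq_card/subsetP => _ /imsetP[a Ta ->]; apply: QF => //.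
  exact: (subsetP TD).
have km : (#|T| <= #|D|)%N by exact: subset_leq_card.
have m0 : (0 < #|D|)%N by rewrite card_gt0.
have sumT a : a \in T -> (#|F|%:R - (-1) ^+ d - #|T|%:R + 1) * phi e
    + \sum_(b in D :\: T) phi (reslot e (tperm a b)) = 0.
  move=> Ta; rewrite -[RHS](eigphi e a Qe (subsetP TD _ Ta)).
  have Tdiff b : b \in T -> a != b -> b != a by rewrite eq_sym.
  have -> : \sum_(b in D | b != a) phi (reslot e (tperm a b)) =
      - (#|T|%:R - 1) * phi e + \sum_(b in D :\: T) phi (reslot e (tperm a b)).
    rewrite (bigID (mem T)) /=; congr (_ + _); last first.
      apply: eq_bigl => b; rewrite inE; case: eqP => [->|_]; first by rewrite Ta !andbF.
      by rewrite andbT andbC.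
    rewrite (eq_bigr (fun=> - phi e)); last first.
      by move=> b /andP[/andP[_ ba] Tb]; rewrite altT // eq_sym.
    rewrite sumr_const (_ : #|_| = #|T :\ a|); last first.
      apply: eq_card => b; rewrite !inE unfold_in /= andbAC andbC; congr (_ && _).
      by case Tb: (b \in T); rewrite ?andbF // (subsetP TD _ Tb).
    by rewrite (cardsD1 a T) Ta add1n -natr1 -mulr_natl; ring.
  ring.
have key : (#|T|%:R * (#|F|%:R - (-1) ^+ d - #|T|%:R + 1) + (#|D|%:R - #|T|%:R)) * phi e = 0.
  have := eq_bigr (fun=> 0) sumT : \sum_(a in T) _ = _; rewrite big_split /= exchange_big /=.
  have -> : \sum_(b in D :\: T) \sum_(a in T) phi (reslot e (tperm a b))
      = \sum_(b in D :\: T) phi e by apply: eq_bigr => b /setDP[]; exact: swapb.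
  rewrite big1_eq !sumr_const -[X in X + _ = _]mulr_natl -[X in _ + X = _]mulr_natl.
  rewrite cardsD (setIidPr TD) natrB // => H.
  by rewrite -[RHS]H; ring.
(* With [n = #|F|], [k = #|T|], [m = #|D|], the alternating case gives [k (n - k + 2) + (m - k) = 0]
   in the natural numbers, which forces [m = 0]. The symmetric case gives [k (n - k) + (m - k) = 0],
   hence [T = D]; then [e] is injective on [D], each of its values occurs once, and [even_support]
   applies. *)
move: key => /eqP; rewrite mulf_eq0 (negPf nz) orbF => /eqP; case d_eq: d => key.
  have /eqP : (#|T| * (#|F| - #|T| + 2) + (#|D| - #|T|))%:R = 0 :> K.
    by rewrite -[RHS]key natrD natrM natrD (natrB _ km) (natrB _ kn); ring.
  by rewrite pnatr_eq0 addn_eq0 muln_eq0; lia.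
have /eqP : (#|T| * (#|F| - #|T|) + (#|D| - #|T|))%:R = 0 :> K.
  by rewrite -[RHS]key natrD natrM (natrB _ km) (natrB _ kn); ring.
rewrite pnatr_eq0 addn_eq0 => E0.
have DT : T = D by apply/eqP; rewrite eqEcard TD; lia.
have [a Da] := set0Pn _ D0; move/eqP: (nz); apply; apply: (evphi _ _ (e a)) => //.
- by rewrite d_eq.
- exact: QF.
- rewrite (_ : [set _ in _ | _] = [set a]) ?cards1 //; apply/setP => b; rewrite !inE.
  apply/andP/eqP => [[Db /eqP eab]|->]; last by rewrite Da eqxx.
  by apply: (alternating_inj Qe altT nz); rewrite ?DT.
Qed.

Lemma swap_eigen_eq0 phi : D != set0 -> swap_eigen phi -> even_support phi ->
  forall e, Q e -> phi e = 0.
Proof.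
move=> D0 eigphi evphi; apply: (swap_eigen_alternating_eq0 D0 (sub0set D)) => //.
by move=> e a b _; rewrite inE.
Qed.

End Swap.

(** * Contractions of tensors *)

Section Update.
Variables (A : finType) (E : Type).
Implicit Types (e : {ffun A -> E}).

Definition upd e a p : {ffun A -> E} := [ffun c => if c == a then p else e c].

Lemma upd_same e a p : upd e a p a = p.
Proof. by rewrite ffunE eqxx. Qed.

Lemma upd_other e a p c : c != a -> upd e a p c = e c.
Proof. by rewrite ffunE => /negPf->. Qed.

Lemma upd_upd e a p q : upd (upd e a p) a q = upd e a q.
Proof. by apply/ffunP => c; rewrite !ffunE; case: eqP. Qed.

Lemma upd_id e a : upd e a (e a) = e.
Proof. by apply/ffunP => c; rewrite ffunE; case: eqP => [->|]. Qed.

Lemma updC e a b p q : a != b -> upd (upd e a p) b q = upd (upd e b q) a p.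
Proof.
move=> ab; apply/ffunP => c; rewrite !ffunE; case: eqP => [->|//].
by rewrite eq_sym (negPf ab).
Qed.

End Update.

Lemma upd_swap (A E : finType) (e : {ffun A -> E}) a b : a != b ->
  upd (upd e a (e b)) b (e a) = reslot e (tperm a b).
Proof.
move=> ab; apply/ffunP => c; rewrite !ffunE; case: tpermP => [->|->|/eqP/negPf-> /eqP/negPf->//].
  by rewrite (negPf ab) eqxx.
by rewrite eqxx.
Qed.

Lemma sum_pick (K : pzRingType) (E : finType) (P : pred E) (q : E) (F : E -> K) :
  P q -> \sum_(p | P p) (q == p)%:R * F p = F q.
Proof.
move=> Pq; rewrite (bigD1 q) //= eqxx mul1r big1 ?addr0 // => p /andP[_ pq].
by rewrite eq_sym (negPf pq) mul0r.
Qed.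

Section Contraction.
Variables (K : numFieldType) (A E : finType) (J : eqType).
Variables (gr : E -> J) (sg : E -> E) (ep : E -> K) (dl : J -> bool) (star : E).
Hypothesis gr_sg : forall p, gr (sg p) = gr p.
Hypothesis sgK : involutive sg.
Hypothesis ep2 : forall p, ep p * ep p = 1.
Hypothesis ep_sg : forall p, ep (sg p) = (-1) ^+ dl (gr p) * ep p.
Hypothesis sg_id : forall p, ~~ dl (gr p) -> sg p = p.
Hypothesis gr_star : forall p, gr p = gr star -> p = star.
Hypothesis dl_star : ~~ dl (gr star).
Implicit Types (e : {ffun A -> E}) (f : {ffun A -> E} -> K) (S : {set A}).

(** Contraction with the inverse form of block [i]. The result is still a function of all slots, but
    no longer depends on [e a] and [e b]; the set [S] of live slots shrinks instead of the type
    [A]. *)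
Definition contract i a b f e : K :=
  \sum_(p | gr p == i) ep p * f (upd (upd e a p) b (sg p)).

(* The skew-adjoint operator [w |-> u (v, w) - delta v (u, w)] acting on the slot [a]. *)
Definition skew_slot u v a f e : K :=
  ep v * (e a == sg v)%:R * f (upd e a u)
  - (-1) ^+ dl (gr u) * ep u * (e a == sg u)%:R * f (upd e a v).

Definition skew_inv S f := forall u v e, gr u = gr v -> gr u != gr star ->
  \sum_(a in S) skew_slot u v a f e = 0.

Definition even_inv S f := forall p e, gr p != gr star -> ~~ dl (gr p) ->
  odd #|[set a in S | e a == p]| -> f e = 0.

(** The inverse of an invariant form is an invariant tensor, so the slots [a] and [b] together
    contribute nothing to the Lie action, and the invariance over [S] reduces to the remaining
    slots. *)
Lemma contract_skew_inv S f i a b : a \in S -> b \in S -> a != b ->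
  skew_inv S f -> skew_inv (S :\ a :\ b) (contract i a b f).
Proof.
move=> Sa Sb ab invf u v e uv ustar.
have ba : b != a by rewrite eq_sym.
pose e' p := upd (upd e a p) b (sg p).
have e'a p : e' p a = p by rewrite /e' upd_other // upd_same.
have e'b p : e' p b = sg p by rewrite /e' upd_same.
have -> : \sum_(c in S :\ a :\ b) skew_slot u v c (contract i a b f) e =
    \sum_(p | gr p == i) ep p * \sum_(c in S :\ a :\ b) skew_slot u v c f (e' p).
  under [RHS]eq_bigr do rewrite mulr_sumr; rewrite [RHS]exchange_big /=.
  apply: eq_bigr => c; rewrite !inE => /and3P[cb ca _].
  rewrite /skew_slot /contract !mulr_sumr -sumrB; apply: eq_bigr => p _.
  have e'c : e' p c = e c by rewrite /e' !upd_other.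
  have updc w : upd (e' p) c w = upd (upd (upd e c w) a p) b (sg p).
    by rewrite /e' (updC _ _ _ (_ : b != c)) 1?eq_sym // (updC _ _ _ (_ : a != c)) // eq_sym.
  by rewrite e'c !updc mulrBr; congr (_ - _); rewrite mulrCA.
have split_sum p : \sum_(c in S :\ a :\ b) skew_slot u v c f (e' p) =
    - (skew_slot u v a f (e' p) + skew_slot u v b f (e' p)).
  apply/eqP; rewrite -addr_eq0; apply/eqP; rewrite -[RHS](invf u v (e' p)) //.
  rewrite [RHS](bigD1 a) //= [X in _ = _ + X](bigD1 b) ?Sb //= [RHS]addrA [RHS]addrC.
  congr (_ + _); apply: eq_bigl => c; rewrite !inE.
  by case: (c \in S); rewrite ?andbF ?andbT // andbC.
under eq_bigr do rewrite split_sum mulrN mulrDr.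
rewrite sumrN big_split /=.
(* For a block other than [i] both contributions vanish; in block [i] they are opposite differences
   of two values of [f]. *)
have [iu|niu] := eqVneq (gr u) i; last first.
  have ne p w : gr w = gr u -> gr p == i -> (p == w) = false.
    move=> gw /eqP gp; apply/eqP => pw; move/eqP: niu; apply.
    by rewrite -gw -pw.
  have ne' p w : gr w = gr u -> gr p == i -> (sg p == w) = false.
    by move=> gw; rewrite -(gr_sg p); exact: ne.
  rewrite !big1 ?addr0 ?oppr0 // => p gp; rewrite /skew_slot ?e'a ?e'b.
    by rewrite !ne' ?gr_sg // !(mulr0, mul0r) subr0 mulr0.
  by rewrite !ne ?gr_sg // !(mulr0, mul0r) subr0 mulr0.
have gui : gr u == i by rewrite iu.
have gvi : gr v == i by rewrite -uv iu.
rewrite (_ : \sum_(p | _) _ = (-1) ^+ dl (gr u) * f (upd (upd e a u) b v) - f (upd (upd e a v) b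
  u)).
  rewrite (_ : \sum_(p | _) _ = f (upd (upd e a v) b u)
      - (-1) ^+ dl (gr u) * f (upd (upd e a u) b v)); last first.
    transitivity (\sum_(p | gr p == i) ((v == p)%:R * (ep p * ep v * f (upd (upd e a p) b u))
      - (u == p)%:R * ((-1) ^+ dl (gr u) * (ep p * ep u) * f (upd (upd e a p) b v)))).
      apply: eq_bigr => p gp; rewrite /skew_slot e'b !(inj_eq (inv_inj sgK)) !upd_upd.
      by rewrite ![p == _]eq_sym; ring.
    by rewrite sumrB !sum_pick // !ep2 mul1r mulr1.
  by ring.
transitivity (\sum_(p | gr p == i) ((sg v == p)%:R * (ep p * ep v * f (upd (upd e a u) b (sg p)))
      - (sg u == p)%:R * ((-1) ^+ dl (gr u) * (ep p * ep u) * f (upd (upd e a v) b (sg p))))).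
  apply: eq_bigr => p gp; rewrite /skew_slot e'a.
  rewrite /e' !(updC _ _ _ (_ : b != a)) // !upd_upd ![p == _]eq_sym; ring.
rewrite sumrB !sum_pick ?gr_sg // !sgK !ep_sg -uv -!mulrA [ep u * (_ * _)]mulrA [ep v * (_ *
  _)]mulrA !ep2.
by rewrite !mul1r mulrA -expr2 sqrr_sign mul1r.
Qed.

(** As [sg] fixes [p], the two contracted slots take the value [p] together and do not change the
    parity. *)
Lemma contract_even_inv S f i a b : a \in S -> b \in S -> a != b ->
  even_inv S f -> even_inv (S :\ a :\ b) (contract i a b f).
Proof.
move=> Sa Sb ab evf p e pstar dp op; rewrite /contract big1 // => q _.
rewrite (evf p) ?mulr0 //.
have ba : b != a by rewrite eq_sym.
rewrite (cardsD1 a) (cardsD1 b) !inE Sa Sb ba upd_same upd_other // upd_same /=.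
have -> : (sg q == p) = (q == p).
  by rewrite -[p in LHS](sg_id dp) (inj_eq (inv_inj sgK)).
rewrite addnA addnn oddD odd_double /=.
suff <- : [set c in S :\ a :\ b | e c == p]
    = [set c in S | upd (upd e a q) b (sg q) c == p] :\ a :\ b by [].
apply/setP => c; rewrite !inE; case: (eqVneq c b) => //= cb.
by case: (eqVneq c a) => //= ca; rewrite !upd_other.
Qed.

Lemma traceless_inv_eq0 S f e a : a \in S -> gr (e a) != gr star ->
  skew_inv S f -> even_inv S f ->
  (forall b c, b \in S -> c \in S -> b != c -> contract (gr (e a)) b c f =1 fun=> 0) ->
  f e = 0.
Proof.
move=> Sa astar invf evf tr0; set i := gr (e a) in astar tr0 *.
pose D := [set c in S | gr (e c) == i]; pose F := [set p | gr p == i].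
pose Q (e1 : {ffun A -> E}) := forall c, c \in S -> (gr (e1 c) == i) = (c \in D).
have DS c : c \in D -> c \in S by rewrite inE => /andP[].
have QF e1 c : Q e1 -> c \in D -> e1 c \in F.
  by move=> Qe1 Dc; rewrite inE Qe1 ?DS.
have Qswap e1 b c : Q e1 -> b \in D -> c \in D -> Q (reslot e1 (tperm b c)).
  move=> Qe1 Db Dc x Sx; rewrite ffunE Qe1; first exact: tperm_stable.
  by case: tpermP => // _; exact: DS.
apply: (swap_eigen_eq0 (D := D) (F := F) (d := dl i) (Q := Q) QF Qswap).
- by apply/set0Pn; exists a; rewrite inE Sa eqxx.
- move=> e1 b Qe1 Db; have Sb := DS _ Db.
  have gb : gr (e1 b) == i by rewrite Qe1.
  (* In the invariance equation for the pair [e1 b], [v], the slot [b] receives the index [sg v];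
     summing over [v] with weight [ep v] contracts it. The slot [b] then yields [n - delta], and any
     other slot yields a swap, if it lies in [D], and a contraction of [f], which is zero. *)
  have lie v : gr v == i -> ep v * \sum_(c in S) skew_slot (e1 b) v c f (upd e1 b (sg v)) = 0.
    by move=> /eqP gv; rewrite invf ?mulr0 // (eqP gb).
  have {}lie : \sum_(v | gr v == i) ep v *
      \sum_(c in S) skew_slot (e1 b) v c f (upd e1 b (sg v)) = 0 by exact: big1.
  rewrite -[RHS]lie.
  pose X := \sum_(v | gr v == i) (ep v * skew_slot (e1 b) v b f (upd e1 b (sg v))).
  pose Y c := \sum_(v | gr v == i) (ep v * skew_slot (e1 b) v c f (upd e1 b (sg v))).
  have -> : \sum_(v | gr v == i) ep v * \sum_(c in S) skew_slot (e1 b) v c f (upd e1 b (sg v))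
      = X + \sum_(c in S | c != b) Y c.
    under eq_bigr do rewrite mulr_sumr; by rewrite exchange_big /= (bigD1 b).
  congr (_ + _).
    rewrite /X mulrBl -sum1_card.
    rewrite (_ : \sum_(v | _) _ = \sum_(v | gr v == i) (f e1 - (e1 b == v)%:R * ((-1) ^+ dl i * f
      (upd e1 b v)))).
      rewrite sumrB sum_pick // upd_id natr_sum mulr_suml; congr (_ - _).
      by apply: eq_big => [v|v _]; rewrite ?inE // mul1r.
    apply: eq_bigr => v gv; rewrite /skew_slot upd_same !upd_upd eqxx mulr1 (eqP gb).
    rewrite upd_id (inj_eq (inv_inj sgK)) [v == _]eq_sym; case: eqP => [<-|_].
      rewrite upd_id mul1r mulr1 mulrBr mulrA ep2 mul1r; congr (_ - _).
      by rewrite -(mulrA _ (ep _)) mulrCA (mulrA (ep _)) ep2 mul1r.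
    by rewrite !(mulr0, mul0r) !subr0 mulrA ep2 mul1r.
  have Yc c : c \in S -> c != b ->
      Y c = if c \in D then f (reslot e1 (tperm b c)) else 0.
    move=> Sc cb; have bc : b != c by rewrite eq_sym.
    have tr : \sum_(v | gr v == i) ep v * ((-1) ^+ dl i * ep (e1 b) * (e1 c == sg (e1 b))%:R *
        f (upd (upd e1 b (sg v)) c v)) = 0.
      transitivity ((-1) ^+ dl i * ep (e1 b) * (e1 c == sg (e1 b))%:R * contract i c b f e1).
        by rewrite mulr_sumr; apply: eq_bigr => v _; rewrite mulrCA updC.
      by rewrite tr0 ?mulr0.
    rewrite /Y /skew_slot (eqP gb); under eq_bigr do rewrite upd_other // mulrBr.
    rewrite sumrB tr subr0; case: ifP => Dc.
      have gc : gr (sg (e1 c)) == i by rewrite gr_sg Qe1.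
      rewrite -upd_swap // -[in RHS](sgK (e1 c)) -(@sum_pick _ _ (fun v => gr v == i) _ (fun v =>
        f (upd (upd e1 b (sg v)) c (e1 b))) gc).
      apply: eq_bigr => v gv; rewrite (can2_eq sgK sgK) !mulrA ep2 mul1r //.
    rewrite big1 // => v gv; case: eqP => [ec|_]; last by rewrite !(mulr0, mul0r).
    by move: Dc; rewrite -Qe1 // ec gr_sg gv.
  rewrite [RHS](eq_bigr (fun c => if c \in D then f (reslot e1 (tperm b c)) else 0)).
    rewrite -big_mkcondr; apply: eq_bigl => c; rewrite andbAC.
    by case Dc: (c \in D); rewrite ?andbF // DS.
  by move=> c /andP[]; exact: Yc.
- move=> di e1 p Qe1; rewrite inE => /eqP gp op; apply: (evf p); rewrite ?gp //.
  move: op; congr (odd #|pred_of_set _|); apply/setP => c; rewrite [LHS]inE [RHS]inE.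
  case: eqP => [ec|_]; rewrite ?andbF ?andbT //.
  have [Sc|nSc] := boolP (c \in S); first by rewrite -Qe1 // ec gp eqxx.
  by apply: contraNF nSc; exact: DS.
- by move=> c Sc; rewrite inE Sc.
Qed.

Definition pairing : Type := J * A * A.

Definition slots (mu : seq pairing) : seq A := flatten [seq [:: o.1.2; o.2] | o <- mu].

Definition contracts (mu : seq pairing) f :=
  foldl (fun f o => contract o.1.1 o.1.2 o.2 f) f mu.

(* A vertex without group action has a single basis vector [star], so two remaining slots
   carrying [star] can be contracted with each other. *)
Lemma inv_eq0 S f : ~~ odd #|S| -> skew_inv S f -> even_inv S f ->
  (forall mu, perm_eq (slots mu) (enum S) -> contracts mu f =1 fun=> 0) ->
  f =1 fun=> 0.
Proof.
have [n] := ubnP #|S|; elim: n => // n IHn in S f *; move=> ltSn evS invf evf mu0 e.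
have tr0 i b c : b \in S -> c \in S -> b != c -> contract i b c f =1 fun=> 0.
  move=> Sb Sc bc; have cb : c != b by rewrite eq_sym.
  have cS : #|S| = #|S :\ b :\ c|.+2.
    by rewrite (cardsD1 b) Sb (cardsD1 c (S :\ b)) !inE cb Sc.
  apply: (IHn (S :\ b :\ c)).
  - by move: ltSn; rewrite cS; lia.
  - by move: evS; rewrite cS /= negbK.
  - exact: contract_skew_inv.
  - exact: contract_even_inv.
  - move=> mu Hmu; apply: (mu0 ((i, b, c) :: mu)).
    rewrite /slots /=; apply: uniq_perm; rewrite ?enum_uniq //=.
      rewrite inE negb_or bc (perm_uniq Hmu) enum_uniq andbT.
      by rewrite !(perm_mem Hmu) !mem_enum !inE !eqxx andbF.
    move=> x; rewrite !inE (perm_mem Hmu) !mem_enum !inE.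
    case: (eqVneq x b) => [->|xb] /=; first by rewrite Sb.
    by case: (eqVneq x c) => [->|xc] /=; rewrite ?Sc ?orbT.
have [a /andP[Sa ga]|noG] := pickP (fun a => (a \in S) && (gr (e a) != gr star)).
  exact: traceless_inv_eq0 Sa ga invf evf (tr0 _).
have eS a : a \in S -> e a = star.
  by move=> Sa; apply: gr_star; move: (noG a); rewrite Sa /= => /negbFE/eqP.
have [S0|[a Sa]] := set_0Vmem S.
  by apply: (mu0 [::]); rewrite S0 enum_set0.
have [S1|[b]] := set_0Vmem (S :\ a).
  by move: evS; rewrite (cardsD1 a) Sa S1 cards0.
rewrite !inE => /andP[ba Sb]; have ab : a != b by rewrite eq_sym.
have := tr0 (gr star) a b Sa Sb ab e; rewrite /contract (bigD1 star) //= big1 ?addr0.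
  have -> : upd (upd e a star) b (sg star) = e.
    by rewrite sg_id // -{1}(eS a Sa) upd_id -(eS b Sb) upd_id.
  move=> /eqP; rewrite mulf_eq0 => /orP[/eqP e0|/eqP //].
  by move: (ep2 star); rewrite e0 mul0r => /eqP; rewrite eq_sym oner_eq0.
by move=> p /andP[/eqP gp]; rewrite (gr_star gp) eqxx.
Qed.

End Contraction.

(** * Contracted words are products of traces *)

Section Tracing.
Variables (K : numFieldType) (A E : finType) (J : eqType) (X : Type).
Variables (gr : E -> J) (sg : E -> E) (ep : E -> K).
Local Notation form := (X -> E -> E -> K).
Variables (good : form -> Prop) (R : (X -> K) -> Prop).
Implicit Types (Y : form) (e : {ffun A -> E}) (f : {ffun A -> E} -> K).

Definition flip Y : form := fun x u v => Y x v u.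

(** Multiplication of bilinear forms through the inverse of the monomial form on block [i];
    [form_trace] closes up a single form in the same way. *)
Definition form_comp i Y Y' : form :=
  fun x u v => \sum_(p | gr p == i) ep p * (Y x u p * Y' x (sg p) v).

Definition form_trace i Y x := \sum_(p | gr p == i) ep p * Y x p (sg p).

Hypothesis good_flip : forall Y, good Y -> good (flip Y).
Hypothesis good_comp : forall i Y Y', good Y -> good Y' -> good (form_comp i Y Y').
Hypothesis good_trace : forall i Y, good Y -> R (form_trace i Y).
Hypothesis R1 : R (fun=> 1).
Hypothesis RM : forall r s, R r -> R s -> R (fun x => r x * s x).

Definition letter : Type := form * A * A.
Implicit Types (ls : seq letter).

Definition letter_slots ls : seq A := flatten [seq [:: l.1.2; l.2] | l <- ls].

Definition word_val ls x e : K := \prod_(l <- ls) l.1.1 x (e l.1.2) (e l.2).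

Fixpoint good_letters ls := if ls is l :: ls' then good l.1.1 /\ good_letters ls' else True.

(** Flipping, if needed, makes [a] the second slot of its letter, so that letters meeting at a
    contraction are joined in one way only. *)
Lemma pull_letter a ls : good_letters ls -> a \in letter_slots ls ->
  exists Y c ls', [/\ good Y, good_letters ls',
    perm_eq (letter_slots ls) [:: a, c & letter_slots ls'] &
    forall x e, word_val ls x e = Y x (e c) (e a) * word_val ls' x e].
Proof.
elim: ls => // [[[Y c] d] ls] IHls [/= gY gls].
rewrite !inE => /or3P[/eqP->|/eqP->|als].
- exists (flip Y), d, ls; split=> //; first exact: good_flip.
  by move=> x e; rewrite /word_val big_cons.
- exists Y, c, ls; split=> //.
    by rewrite /letter_slots /= -(cat1s d) -(cat1s c) perm_catCA.
  by move=> x e; rewrite /word_val big_cons.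
have [Y' [c' [ls' [gY' gls' Hperm Hval]]]] := IHls gls als.
exists Y', c', ((Y, c, d) :: ls'); split=> //.
  rewrite -[X in perm_eq X _]/([:: c; d] ++ letter_slots ls).
  rewrite -[X in perm_eq _ X]/([:: a; c'] ++ [:: c; d] ++ letter_slots ls').
  by rewrite perm_sym perm_catCA perm_cat2l perm_sym.
by move=> x e; rewrite /word_val !big_cons -!/(word_val _ _ _) Hval /= mulrCA.
Qed.

Lemma word_val_upd ls x e a p : a \notin letter_slots ls ->
  word_val ls x (upd e a p) = word_val ls x e.
Proof.
elim: ls => [|[[Y c] d] ls IHls]; first by rewrite /word_val !big_nil.
rewrite !inE !negb_or => /and3P[ac ad als].
by rewrite /word_val !big_cons -!/(word_val _ _ _) IHls //= !upd_other // eq_sym.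
Qed.

Local Notation contract := (contract gr sg ep).
Local Notation contracts := (contracts gr sg ep).

(** If [a] and [b] are the ends of one letter, the contraction closes it to a trace; otherwise it
    joins two letters into one, and the scalar factor is 1. *)
Lemma contract_word i a b ls : good_letters ls -> a \in letter_slots ls ->
  b \in letter_slots ls -> a != b -> uniq (letter_slots ls) ->
  exists r ls', [/\ R r, good_letters ls',
    perm_eq (letter_slots ls) [:: a, b & letter_slots ls'] &
    forall x e, contract i a b (word_val ls x) e = r x * word_val ls' x e].
Proof.
move=> gls als bls ab uls; have ba : b != a by rewrite eq_sym.
have [Y [c [ls1 [gY gls1 perm1 val1]]]] := pull_letter gls als.
move: (uls); rewrite (perm_uniq perm1) /= inE negb_or => /and3P[/andP[ac als1] cls1 uls1].
have ca : c != a by rewrite eq_sym.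
have [bc|bc] := eqVneq b c.
  exists (form_trace i (flip Y)), ls1; split=> //.
  - exact/good_trace/good_flip.
  - by rewrite bc.
  - move=> x e; rewrite /contract /form_trace mulr_suml; apply: eq_bigr => p _.
    rewrite val1 !word_val_upd // ?bc //.
    by rewrite -bc upd_same upd_other // upd_same mulrA.
have bls1 : b \in letter_slots ls1.
  by move: bls; rewrite (perm_mem perm1) !inE (negPf ba) (negPf bc).
have [Y' [d [ls2 [gY' gls2 perm2 val2]]]] := pull_letter gls1 bls1.
move: (uls1); rewrite (perm_uniq perm2) /= inE negb_or => /and3P[/andP[bd bls2] dls2 uls2].
move: als1 cls1; rewrite !(perm_mem perm2) !inE !negb_or => /and3P[_ ad als2] /and3P[cb cd cls2].
exists (fun=> 1), ((form_comp i Y (flip Y'), c, d) :: ls2); split=> //=.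
- by split=> //; exact/good_comp/good_flip.
- rewrite (perm_trans perm1) // perm_cons -[X in perm_eq _ X]/([:: b] ++ [:: c] ++ (d ::
    letter_slots ls2)).
  by rewrite perm_sym perm_catCA /= perm_cons perm_sym.
- move=> x e; rewrite mul1r.
  have -> : word_val ((form_comp i Y (flip Y'), c, d) :: ls2) x e =
      form_comp i Y (flip Y') x (e c) (e d) * word_val ls2 x e by rewrite /word_val big_cons.
  rewrite /contract mulr_suml.
  apply: eq_bigr => p _; rewrite val1 val2 !word_val_upd //.
  have da : d != a by rewrite eq_sym.
  have db : d != b by rewrite eq_sym.
  rewrite upd_same !(upd_other _ _ (_ : c != b)) // !(upd_other _ _ (_ : d != b)) //.
  by rewrite !(upd_other _ _ ca) (upd_other _ _ da) (upd_other _ _ ab) upd_same !mulrA.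
Qed.

Lemma eq_contracts mu f g : f =1 g -> contracts mu f =1 contracts mu g.
Proof.
elim: mu f g => //= o mu IHmu f g fg; apply: IHmu => e.
by apply: eq_bigr => p _; rewrite fg.
Qed.

Lemma contracts_sum (I : Type) (s : seq I) (c : I -> K) (F : I -> {ffun A -> E} -> K) mu e :
  contracts mu (fun e' => \sum_(k <- s) c k * F k e') e = \sum_(k <- s) c k * contracts mu (F k) e.
Proof.
elim: mu F => //= o mu IHmu F; rewrite -IHmu; apply: eq_contracts => e'.
rewrite /contract; under eq_bigr do rewrite mulr_sumr; rewrite exchange_big /=.
by apply: eq_bigr => k _; rewrite mulr_sumr; apply: eq_bigr => p _; rewrite mulrCA.
Qed.

Lemma contractsZ mu c f e : contracts mu (fun e' => c * f e') e = c * contracts mu f e.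
Proof.
have := contracts_sum [:: tt] (fun=> c) (fun=> f) mu e; rewrite big_seq1 => <-.
by apply: eq_contracts => e'; rewrite big_seq1.
Qed.

(* A perfect matching of the slots of a word joins its letters into closed chains; each
   chain contributes a trace. *)
Lemma contracts_word mu ls : good_letters ls -> uniq (letter_slots ls) ->
  perm_eq (slots mu) (letter_slots ls) ->
  exists2 r, R r & forall x e, contracts mu (word_val ls x) e = r x.
Proof.
elim: mu ls => [|[[i a] b] mu IHmu] ls gls uls.
  case: ls gls uls => [|l ls] _ _; last by move=> /perm_size.
  by move=> _; exists (fun=> 1) => // x e; rewrite /= /word_val big_nil.
move=> Hperm; have := uls; rewrite -(perm_uniq Hperm) /= inE negb_or => /andP[/andP[ab _] _].
have [||r [ls' [Rr gls' perm' val']]] := contract_word i gls _ _ ab uls.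
- by rewrite -(perm_mem Hperm) !inE eqxx.
- by rewrite -(perm_mem Hperm) !inE eqxx orbT.
have Hperm' : perm_eq (slots mu) (letter_slots ls').
  by have := perm_trans Hperm perm'; rewrite /slots /= !perm_cons.
have uls' : uniq (letter_slots ls').
  by move: uls; rewrite (perm_uniq perm') /= => /and3P[].
have [r' Rr' val''] := IHmu _ gls' uls' Hperm'.
exists (fun x => r x * r' x); first exact: RM.
move=> x e /=; rewrite -(val'' x e) -contractsZ; apply: eq_contracts => e'; exact: val'.
Qed.

End Tracing.

(** * Orthogonal projection *)

(** A matrix of maximal rank among those with row space inside [P] has all of [P] in its row space:
    adjoining a further vector of [P] would raise the rank. *)
Lemma linear_closed_row_space (K : fieldType) n (P : 'rV[K]_n -> Prop) :
  P 0 -> (forall a u v, P u -> P v -> P (a *: u + v)) ->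
  exists M : 'M[K]_n, forall v, P v <-> (v <= M)%MS.
Proof.
move=> P0 PL.
pose Q r := `[< exists M : 'M[K]_n, (forall v : 'rV_n, (v <= M)%MS -> P v) /\ \rank M = r >].
have Q0 : exists r, Q r.
  exists 0%N; apply/asboolP; exists 0; rewrite mxrank0; split=> // v.
  by rewrite submx0 => /eqP->.
have Qn r : Q r -> (r <= n)%N by case/asboolP => M [_ <-]; exact: rank_leq_row.
case: (ex_maxnP Q0 Qn) => r /asboolP[M [MP rM]] rmax.
exists M => v; split=> [Pv|]; last exact: MP.
have QMv : Q (\rank (M + v)%MS).
  apply/asboolP; exists (M + v)%MS; split=> // w /sub_addsmxP[[a b] /= ->].
  rewrite addrC [b]mx11_scalar mul_scalar_mx; apply: PL => //.
  by apply: MP; exact: submxMl.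
have /leqifP := mxrank_leqif_sup (addsmxSl M v).
case: ifP => [vM _|_]; first exact: submx_trans (addsmxSr M v) vM.
by rewrite rM ltnNge rmax.
Qed.

Lemma ortho_projection (K : numClosedFieldType) (T : finType) (U : (T -> K) -> Prop) :
  U (fun=> 0) -> (forall a s t, U s -> U t -> U (fun w => a * s w + t w)) ->
  forall t, exists2 u, U u &
    forall s, U s -> \sum_w (t w - u w) * (s w)^* = 0.
Proof.
move=> U0 UL t.
pose fun_of (v : 'rV[K]_#|T|) w := v 0 (enum_rank w).
pose row_of (s : T -> K) : 'rV[K]_#|T| := \row_j s (enum_val j).
have row_ofK s : fun_of (row_of s) = s.
  by apply/funext => w; rewrite /fun_of mxE enum_rankK.
have [||M MP] := @linear_closed_row_space K _ (fun v => U (fun_of v)).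
- rewrite (_ : fun_of 0 = fun=> 0) //.
  by apply/funext => w; rewrite /fun_of mxE.
- move=> a u v Uu Uv; rewrite (_ : fun_of _ = fun w => a * fun_of u w + fun_of v w).
    exact: UL.
  by apply/funext => w; rewrite /fun_of !mxE.
pose u := row_of t *m proj_ortho M.
exists (fun_of u); first by apply/MP; exact: proj_ortho_sub.
move=> s Us.
have /orthomx1P : (row_of t - u <= orthomx Num.Def.conjC (hermitian1mx _) M)%MS.
  exact: proj_ortho_compl_sub.
have /submxP[a sM] : (row_of s <= M)%MS by apply/MP; rewrite row_ofK.
move=> ort; have : (row_of t - u) *m ((row_of s) ^t* )%sesqui = 0.
  by rewrite sM trmx_mul map_mxM mulmxA ort mul0mx.
move/matrixP => /(_ 0 0); rewrite !mxE => E; rewrite -[RHS]E.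
rewrite (reindex (fun j : 'I_#|T| => enum_val j)) /=; last exact: onW_bij (@enum_val_bij T).
apply: eq_bigr => j _; rewrite !mxE /fun_of enum_valK; congr (_ * _).
by rewrite mxE.
Qed.

(** * Cayley transforms *)

Section Cayley.
Variables (K : fieldType) (N : nat) (X B : 'M[K]_N) (kappa : K).
Hypothesis X3 : X *m X *m X = kappa *: X.

(* Numerator of the Cayley transform [(1 + s X) / (1 - s X)], whose denominator is
   [1 - kappa s ^ 2] because [X ^ 3 = kappa X]. *)
Definition cayley s : 'M[K]_N :=
  (1 - kappa * s ^+ 2) *: 1%:M + (2 * s) *: X + (2 * s ^+ 2) *: (X *m X).

Lemma cayleyE s p q : cayley s p q = (1 - kappa * s ^+ 2) * (p == q)%:R + 2 * s * X p q
  + 2 * s ^+ 2 * \sum_j X p j * X j q.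
Proof. by rewrite !mxE. Qed.

Lemma mul_cubic (a1 a2 a3 b1 b2 b3 : K) :
  (a1 *: 1%:M + a2 *: X + a3 *: (X *m X)) *m (b1 *: 1%:M + b2 *: X + b3 *: (X *m X)) =
  (a1 * b1) *: 1%:M + (a1 * b2 + a2 * b1 + kappa * (a2 * b3 + a3 * b2)) *: X +
  (a1 * b3 + a2 * b2 + a3 * b1 + kappa * a3 * b3) *: (X *m X).
Proof.
have X3' : X *m (X *m X) = kappa *: X by rewrite mulmxA.
have X4 : X *m X *m (X *m X) = kappa *: (X *m X) by rewrite mulmxA X3 -scalemxAl.
rewrite !mulmxDl !mulmxDr -!scalemxAl -!scalemxAr !mul1mx !mulmx1 X3 X3' X4.
rewrite !scalerA; apply/matrixP => i j; rewrite !mxE; ring.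
Qed.

Lemma cayleyK s : cayley (- s) *m cayley s = (1 - kappa * s ^+ 2) ^+ 2 *: 1%:M.
Proof.
rewrite /cayley mul_cubic; apply/matrixP => i j; rewrite !mxE; ring.
Qed.

(** Skewness moves the transpose across [B] as [cayley (- s)], and [cayley (- s)] times [cayley s]
    is the square of the denominator. *)
Lemma cayley_isometry s : X^T *m B = - (B *m X) ->
  (cayley s)^T *m B *m cayley s = (1 - kappa * s ^+ 2) ^+ 2 *: B.
Proof.
move=> skewX; have -> : (cayley s)^T *m B = B *m cayley (- s).
  rewrite /cayley !linearD /= !linearZ /= trmx1 trmx_mul !mulmxDl.
  rewrite -!scalemxAl mul1mx mulmx1 skewX -(mulmxA X^T) skewX mulmxN mulmxA.
  rewrite skewX mulNmx opprK mulmxA sqrrN mulrN scaleNr scalerN //.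
by rewrite -mulmxA cayleyK -scalemxAr mulmx1.
Qed.

End Cayley.

(** The image of [X] lies in the span of [u] and [v], where [X] acts by a two by two matrix of trace
    zero; by Cayley-Hamilton its square there is minus the determinant. *)
Lemma rank2_cubic (K : fieldType) N (u v : 'cV[K]_N) (a c : 'rV[K]_N) (dl al be ga : K) :
  dl * dl = 1 -> a *m u = al%:M -> a *m v = be%:M -> c *m u = ga%:M -> c *m v = (dl * al)%:M ->
  let X := u *m a - dl *: (v *m c) in X *m X *m X = (al ^+ 2 - dl * ga * be) *: X.
Proof.
move=> dl2 au av cu cv X.
have Xu : X *m u = al *: u - (dl * ga) *: v.
  by rewrite mulmxBl -scalemxAl -!mulmxA au cu !mul_mx_scalar scalerA.
have Xv : X *m v = be *: u - al *: v.
  by rewrite mulmxBl -scalemxAl -!mulmxA av cv !mul_mx_scalar scalerA mulrA dl2 mul1r.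
set k := _ - _.
have XXu : X *m (X *m u) = k *: u.
  rewrite Xu mulmxBr -!scalemxAr Xu Xv; apply/matrixP => i j; rewrite !mxE /k; ring.
have XXv : X *m (X *m v) = k *: v.
  rewrite Xv mulmxBr -!scalemxAr Xu Xv; apply/matrixP => i j; rewrite !mxE /k; ring.
suff H Z : Z = u *m a - dl *: (v *m c) -> X *m (X *m Z) = k *: Z by rewrite -mulmxA H.
move=> ->; rewrite !mulmxBr -!scalemxAr !mulmxA -(mulmxA X X u) XXu -(mulmxA X X v) XXv.
by rewrite scalerBr -!scalemxAl !scalerA [dl * k]mulrC.
Qed.

Lemma deriv_prod_seq (K : fieldType) (I : eqType) (r : seq I) (F : I -> {poly K}) : uniq r ->
  (\prod_(i <- r) F i)^`() = \sum_(i <- r) (F i)^`() * \prod_(j <- r | j != i) F j.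
Proof.
elim: r => [|i r IHr] /=; first by rewrite !big_nil derivC.
case/andP=> ir ur; rewrite !big_cons derivM IHr // eqxx /=; congr (_ + _).
  congr (_ * _); rewrite [LHS]big_seq [RHS]big_seq_cond; apply: eq_bigl => j.
  by case jr: (j \in r) => //=; apply/esym; apply: contraTneq jr => ->.
rewrite mulr_sumr [LHS]big_seq [RHS]big_seq; apply: eq_bigr => j jr.
rewrite big_cons; case: eqVneq => [ij|_]; last by rewrite mulrCA.
by rewrite ij jr in ir.
Qed.

Lemma deriv_prod (K : fieldType) (I : finType) (F : I -> {poly K}) :
  (\prod_i F i)^`() = \sum_i (F i)^`() * \prod_(j | j != i) F j.
Proof. exact: (deriv_prod_seq F (index_enum_uniq I)). Qed.

Lemma poly_eq0_horner (K : numFieldType) (p : {poly K}) : (forall s, p.[s] = 0) -> p = 0.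
Proof.
move=> p0; apply/eqP/negPn/negP => nz.
have := max_poly_roots nz (rs := [seq i%:R | i <- iota 0 (size p)]).
rewrite size_map size_iota ltnn => H; apply: notF; apply: H.
  by apply/allP => x _; apply/rootP.
by rewrite map_inj_uniq ?iota_uniq //; exact: mulrIn (oner_neq0 K).
Qed.

(** * Isometries of a monomial form *)

Section Invariants.
Variables (K : numClosedFieldType) (N : nat) (J : eqType).
Variables (gr : 'I_N -> J) (sg : 'I_N -> 'I_N) (ep : 'I_N -> K) (dl : J -> bool) (star : 'I_N).
Hypothesis gr_sg : forall p, gr (sg p) = gr p.
Hypothesis sgK : involutive sg.
Hypothesis ep2 : forall p, ep p * ep p = 1.
Hypothesis ep_sg : forall p, ep (sg p) = (-1) ^+ dl (gr p) * ep p.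
Hypothesis sg_id : forall p, ~~ dl (gr p) -> sg p = p.

Definition gram : 'M[K]_N := \matrix_(p, q) (ep p * (q == sg p)%:R).

(** Coordinates of a block-diagonal isometry. When the block of [star] is one-dimensional, the last
    condition makes the isometry trivial there. *)
Definition gauge (h : 'M[K]_N) : Prop :=
  [/\ h^T *m gram *m h = gram, forall p q, gr p != gr q -> h p q = 0 & h star star = 1].

(** The rank two operator behind [skew_slot], written as columns times rows to fit [rank2_cubic]. *)
Definition skew_mx u v : 'M[K]_N := delta_mx u 0 *m (ep v *: delta_mx 0 (sg v) : 'rV_N)
  - (-1) ^+ dl (gr u) *: (delta_mx v 0 *m (ep u *: delta_mx 0 (sg u) : 'rV_N)).

Lemma skew_mxE u v p w : skew_mx u v p w =
  (p == u)%:R * (ep v * (w == sg v)%:R) - (-1) ^+ dl (gr u) * ((p == v)%:R * (ep u * (w == sg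
    u)%:R)).
Proof.
rewrite /skew_mx -!scalemxAr !mul_delta_mx !mxE !mulrA.
by rewrite -!mulnb !natrM; congr (_ - _); ring.
Qed.

Lemma skew_mx_adj u v : gr u = gr v -> (skew_mx u v)^T *m gram = - (gram *m skew_mx u v).
Proof.
move=> uv; apply/matrixP => p q; rewrite mxE [in RHS]mxE [in RHS]mxE.
transitivity (\sum_j ((u == j)%:R * (ep v * (p == sg v)%:R * (ep j * (q == sg j)%:R))
   - (v == j)%:R * ((-1) ^+ dl (gr u) * (ep u * (p == sg u)%:R) * (ep j * (q == sg j)%:R)))).
  by apply: eq_bigr => j _; rewrite mxE skew_mxE mxE (eq_sym j u) (eq_sym j v); ring.
rewrite sumrB !sum_pick //.
transitivity (- \sum_j ((sg p == j)%:R * (ep p * ((j == u)%:R * (ep v * (q == sg v)%:R)))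
   - (sg p == j)%:R * ((-1) ^+ dl (gr u) * ep p * ((j == v)%:R * (ep u * (q == sg u)%:R)))));
       last first.
  by congr (- _); apply: eq_bigr => j _; rewrite mxE skew_mxE (eq_sym _ j); ring.
rewrite sumrB !sum_pick // !(can2_eq sgK sgK).
have eu : (p == sg u)%:R * ep p = (p == sg u)%:R * ((-1) ^+ dl (gr u) * ep u).
  by case: eqP => [->|]; rewrite ?mul0r // !mul1r ep_sg.
have ev : (p == sg v)%:R * ep p = (p == sg v)%:R * ((-1) ^+ dl (gr u) * ep v).
  by case: eqP => [->|]; rewrite ?mul0r // !mul1r ep_sg uv.
transitivity (- ((p == sg u)%:R * ep p * (ep v * (q == sg v)%:R)
   - (-1) ^+ dl (gr u) * (ep u * (q == sg u)%:R) * ((p == sg v)%:R * ep p))); last by ring.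
rewrite eu ev; have := sqrr_sign K (dl (gr u)); set d := _ ^+ dl _ => d2.
rewrite -[in LHS](mul1r (ep v * _ * _)) -d2; ring.
Qed.

Lemma skew_mx_cubic u v : gr u = gr v -> exists k,
  skew_mx u v *m skew_mx u v *m skew_mx u v = k *: skew_mx u v.
Proof.
move=> uv; set d : K := (-1) ^+ dl (gr u).
have d2 : d * d = 1 by rewrite -expr2 sqrr_sign.
have dE p q : delta_mx 0 p *m delta_mx q 0 = (p == q)%:R%:M :> 'M[K]_1.
  rewrite mul_delta_mx_cond; case: (p == q); rewrite ?mulr1n ?mulr0n ?scalemx0 //.
    by apply/matrixP => i j; rewrite !ord1 !mxE !eqxx.
  by apply/matrixP => i j; rewrite !ord1 !mxE mul0rn.
have XE p q : (ep p *: delta_mx 0 (sg p)) *m delta_mx q 0 = (ep p * (sg p == q)%:R)%:M :> 'M[K]_1.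
  by rewrite -scalemxAl dE scale_scalar_mx.
(* The four products are values of the form on [u] and [v]; the remaining one is
   [(u, v) = delta (v, u)]. *)
eexists; apply: (rank2_cubic d2 (XE v u) (XE v v) (XE u u)).
rewrite XE; congr (_%:M); case: eqP => [<-|ne].
  by rewrite sgK eqxx !mulr1 ep_sg mulrA d2 mul1r.
have -> : (sg v == u) = false by apply/eqP => vu; apply: ne; rewrite -vu sgK.
by rewrite !mulr0.
Qed.

Lemma skew_mx_block u v p q : gr u = gr v -> gr p != gr q -> skew_mx u v p q = 0.
Proof.
move=> uv pq; rewrite skew_mxE.
have neq w1 w2 : gr w1 = gr w2 -> (p == w1)%:R * (q == sg w2)%:R = 0 :> K.
  move=> w12; case: eqP => [pw|]; rewrite ?mul0r //.
  case: eqP => [qw|]; rewrite ?mulr0 //.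
  by move: pq; rewrite pw qw gr_sg w12 eqxx.
rewrite [_ * (ep v * _)]mulrCA neq // [_ * (ep u * _)]mulrCA neq //.
by rewrite !mulr0 subr0.
Qed.

Lemma skew_mx_star u v q : gr u = gr v -> gr u != gr star -> skew_mx u v star q = 0.
Proof.
move=> uv us; rewrite skew_mxE.
have ne w : gr w = gr u -> (star == w) = false.
  by move=> wu; apply/eqP => sw; move/eqP: us; apply; rewrite -wu -sw.
by rewrite !ne // !mul0r mulr0 subr0.
Qed.

Lemma gauge_cayley u v k s : gr u = gr v -> gr u != gr star ->
  skew_mx u v *m skew_mx u v *m skew_mx u v = k *: skew_mx u v ->
  1 - k * s ^+ 2 != 0 ->
  gauge ((1 - k * s ^+ 2)^-1 *: cayley (skew_mx u v) k s).
Proof.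
move=> uv us X3 D0; split.
- rewrite [_^T]linearZ /= -!scalemxAl -scalemxAr (cayley_isometry X3 _ (skew_mx_adj uv)).
  by rewrite !scalerA -expr2 -exprMn mulVf // expr1n scale1r.
- move=> p q pq; rewrite mxE cayleyE (skew_mx_block uv pq) big1 => [|j _].
    have /negPf-> : p != q by apply: contraNneq pq => ->.
    by rewrite !mulr0 !addr0 mulr0.
  case: (eqVneq (gr p) (gr j)) => [pj|pj]; last by rewrite (skew_mx_block uv pj) mul0r.
  by rewrite (skew_mx_block uv (p := j)) ?mulr0 // -pj.
- rewrite mxE cayleyE skew_mx_star // big1 => [|j _]; last by rewrite skew_mx_star // mul0r.
  by rewrite eqxx !mulr0 !addr0 mulr1 mulVf.
Qed.

Definition mirror p : 'M[K]_N := \matrix_(i, j) ((i == j)%:R * (-1) ^+ (i == p)).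

Lemma mirror_trE p (Y : 'M[K]_N) u v :
  ((mirror p)^T *m Y *m mirror p) u v = (-1) ^+ (u == p) * (-1) ^+ (v == p) * Y u v.
Proof.
rewrite mxE.
transitivity (\sum_j (v == j)%:R * ((-1) ^+ (u == p) * Y u j * (-1) ^+ (j == p))).
  apply: eq_bigr => j _; rewrite !mxE (eq_sym j v).
  have -> : \sum_i (mirror p)^T u i * Y i j = (-1) ^+ (u == p) * Y u j.
    transitivity (\sum_i (u == i)%:R * ((-1) ^+ (i == p) * Y i j)).
      by apply: eq_bigr => i _; rewrite !mxE (eq_sym i u) mulrA.
    by rewrite sum_pick.
  ring.
by rewrite sum_pick // mulrAC.
Qed.

(** Here [sg p = p], so the basis vector [p] is orthogonal to all the others, and changing its sign
    is an isometry. *)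
Lemma gauge_mirror p : gr p != gr star -> ~~ dl (gr p) -> gauge (mirror p).
Proof.
move=> ps dp; split.
- apply/matrixP => i j; rewrite mirror_trE !mxE; case: (eqVneq j (sg i)) => [->|];
    last by rewrite !mulr0.
  rewrite -[p in sg i == p](sg_id dp) (inj_eq (inv_inj sgK)) -expr2 sqrr_sign mul1r //.
- move=> i j ij; have /negPf ne : i != j by apply: contraNneq ij => ->.
  by rewrite mxE ne mul0r.
- have /negPf ne : star != p by apply: contraNneq ps => ->.
  by rewrite mxE eqxx mul1r ne.
Qed.

End Invariants.

(** * Invariant tensors *)

(** A change of variable between the index maps with value [p] at [a] and those with value [q]; it
    transposes the operator that rewrites the slot [a]. *)
Lemma sum_upd (K : pzRingType) (A E : finType) (a : A) (p q : E)
    (F : {ffun A -> E} -> {ffun A -> E} -> K) :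
  \sum_(e : {ffun A -> E}) (e a == p)%:R * F e (upd e a q)
  = \sum_(e : {ffun A -> E}) (e a == q)%:R * F (upd e a p) e.
Proof.
transitivity (\sum_(e : {ffun A -> E} | e a == p) F e (upd e a q)).
  by rewrite [RHS]big_mkcond; apply: eq_bigr => e _; case: eqP; rewrite ?mul1r ?mul0r.
transitivity (\sum_(e : {ffun A -> E} | e a == q) F (upd e a p) e); last first.
  by rewrite [LHS]big_mkcond; apply: eq_bigr => e _; case: eqP; rewrite ?mul1r ?mul0r.
rewrite (reindex_onto (fun e => upd e a p) (fun e => upd e a q)) /=.
  apply: eq_big => [e|e /andP[_ /eqP->]//].
  rewrite upd_same eqxx upd_upd; apply/eqP/eqP => [<-|<-]; first by rewrite upd_same.
  exact: upd_id.
by move=> e /eqP ea; rewrite upd_upd -ea upd_id.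
Qed.

Section Tensors.
Variables (K : numClosedFieldType) (N : nat) (J : eqType).
Variables (gr : 'I_N -> J) (sg : 'I_N -> 'I_N) (ep : 'I_N -> K) (dl : J -> bool) (star : 'I_N).
Hypothesis gr_sg : forall p, gr (sg p) = gr p.
Hypothesis sgK : involutive sg.
Hypothesis ep2 : forall p, ep p * ep p = 1.
Hypothesis ep_sg : forall p, ep (sg p) = (-1) ^+ dl (gr p) * ep p.
Hypothesis sg_id : forall p, ~~ dl (gr p) -> sg p = p.
Hypothesis gr_star : forall p, gr p = gr star -> p = star.
Hypothesis dl_star : ~~ dl (gr star).
Variables (X : Type) (L : finType) (Y : L -> X -> 'M[K]_N) (d : nat).

Local Notation A := ('I_d * bool)%type.
Local Notation gauge := (gauge gr sg ep star).
Local Notation skew_slot := (skew_slot gr sg ep dl).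
Local Notation skew_mx := (skew_mx gr sg ep dl).
Implicit Types (e : {ffun A -> 'I_N}) (w : {ffun 'I_d -> L}) (x : X).

Definition tensor_index : finType := ({ffun 'I_d -> L} * {ffun A -> 'I_N})%type.
Implicit Types (t : tensor_index -> K).

Definition word w x e : K := \prod_k Y (w k) x (e (k, false)) (e (k, true)).

Definition tensor_val t x : K := \sum_c t c * word c.1 x c.2.

Definition skew_tensor u v t : tensor_index -> K :=
  fun c => \sum_a skew_slot u v a (fun e => t (c.1, e)) c.2.

(** The group enters only by congruence on the letter matrices, and points of [X] are compared
    through these. *)
Definition isometry_invariant (f : X -> K) :=
  forall h x y, gauge h -> (forall l, Y l y = h^T *m Y l x *m h) -> f y = f x.

(** Because the Gram matrix is monomial, the transpose of the generator of [u], [v] is, up to sign,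
    the generator of [sg v], [sg u]. This is the stability of the Lie algebra under
    transposition. *)
Lemma skew_slot_adj u v a (f g : {ffun A -> 'I_N} -> K) : gr u = gr v ->
  \sum_e skew_slot u v a f e * g e =
  (-1) ^+ dl (gr u) * ep u * ep v * \sum_e f e * skew_slot (sg v) (sg u) a g e.
Proof.
move=> uv; have := sqrr_sign K (dl (gr u)); rewrite /skew_slot gr_sg -uv.
set de : K := _ ^+ dl _ => de2.
transitivity (ep v * (\sum_(e : {ffun A -> 'I_N}) (e a == sg v)%:R * (f (upd e a u) * g e))
   - de * ep u * (\sum_(e : {ffun A -> 'I_N}) (e a == sg u)%:R * (f (upd e a v) * g e))).
  rewrite !mulr_sumr -sumrB; apply: eq_bigr => e _; ring.
rewrite (sum_upd _ _ _ (fun e e' => f e' * g e)) (sum_upd _ _ _ (fun e e' => f e' * g e)).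
rewrite !mulr_sumr -sumrB; apply: eq_bigr => e _.
rewrite !sgK !ep_sg -uv -/de.
transitivity (de ^+ 2 * (ep u * ep u) * ep v * (e a == u)%:R * (f e * g (upd e a (sg v)))
   - de ^+ 2 * (ep v * ep v) * de * ep u * (e a == v)%:R * (f e * g (upd e a (sg u)))).
  by rewrite de2 !ep2; ring.
ring.
Qed.

Lemma sum_index (F : tensor_index -> K) : \sum_c F c = \sum_w \sum_e F (w, e).
Proof. by rewrite pair_bigA; apply: eq_bigr => -[]. Qed.

Lemma skew_tensor_adj u v (s t : tensor_index -> K) : gr u = gr v ->
  \sum_c skew_tensor u v s c * t c =
  (-1) ^+ dl (gr u) * ep u * ep v * \sum_c s c * skew_tensor (sg v) (sg u) t c.
Proof.
move=> uv; rewrite !sum_index mulr_sumr; apply: eq_bigr => w _.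
transitivity (\sum_a \sum_(e : {ffun A -> 'I_N}) skew_slot u v a (fun e => s (w, e)) e * t (w, e)).
  by rewrite exchange_big; apply: eq_bigr => e _; rewrite /skew_tensor mulr_suml.
under eq_bigr do rewrite (skew_slot_adj _ _ (fun e => t (w, e)) uv).
rewrite -mulr_sumr; congr (_ * _); rewrite exchange_big; apply: eq_bigr => e _.
by rewrite /skew_tensor mulr_sumr.
Qed.

Lemma word_upd w x e (k : 'I_d) (b : bool) p : word w x (upd e (k, b) p) =
  (if b then Y (w k) x (e (k, false)) p else Y (w k) x p (e (k, true)))
  * \prod_(j | j != k) Y (w j) x (e (j, false)) (e (j, true)).
Proof.
rewrite /word (bigD1 k) //=; congr (_ * _); first by case: b; rewrite !ffunE !xpair_eqE !eqxx.
by apply: eq_bigr => j jk; rewrite !ffunE !xpair_eqE (negPf jk).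
Qed.

(** Leibniz rule: the two slots of the letter [k] together see the variation [S^T Y + Y S] of its
    matrix, with [S = skew_mx u v]. *)
Lemma skew_slot_word u v w x e (k : 'I_d) :
  skew_slot u v (k, false) (word w x) e + skew_slot u v (k, true) (word w x) e =
  ((skew_mx u v)^T *m Y (w k) x + Y (w k) x *m skew_mx u v) (e (k, false)) (e (k, true))
  * \prod_(j | j != k) Y (w j) x (e (j, false)) (e (j, true)).
Proof.
rewrite /skew_slot !word_upd; set P := \prod_(j | _) _; set de : K := _ ^+ dl _.
set e0 := e (k, false); set e1 := e (k, true); set y := Y (w k) x.
have E0 : ((skew_mx u v)^T *m y) e0 e1 = ep v * (e0 == sg v)%:R * y u e1
    - de * ep u * (e0 == sg u)%:R * y v e1.
  rewrite mxE.
  transitivity (\sum_j ((u == j)%:R * (ep v * (e0 == sg v)%:R * y j e1)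
    - (v == j)%:R * (de * ep u * (e0 == sg u)%:R * y j e1))).
    by apply: eq_bigr => j _; rewrite mxE skew_mxE !(eq_sym _ j) -/de; ring.
  by rewrite sumrB !sum_pick.
have E1 : (y *m skew_mx u v) e0 e1 = ep v * (e1 == sg v)%:R * y e0 u
    - de * ep u * (e1 == sg u)%:R * y e0 v.
  rewrite mxE.
  transitivity (\sum_j ((u == j)%:R * (ep v * (e1 == sg v)%:R * y e0 j)
    - (v == j)%:R * (de * ep u * (e1 == sg u)%:R * y e0 j))).
    by apply: eq_bigr => j _; rewrite skew_mxE !(eq_sym _ j) -/de; ring.
  by rewrite sumrB !sum_pick.
rewrite [in RHS]mxE E0 E1; ring.
Qed.

(** The entries of the Cayley numerator are polynomials in [s]; the factor 2 in the derivative comes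
    from its linear term [2 s S]. *)
Lemma horner_deriv_cayley_form (S M : 'M[K]_N) k (u v : 'I_N) : exists2 F : {poly K},
  (forall s, F.[s] = ((cayley S k s)^T *m M *m cayley S k s) u v) &
  F.[0] = M u v /\ F^`().[0] = 2 * (S^T *m M + M *m S) u v.
Proof.
pose c i j : {poly K} := ((i == j)%:R)%:P * (1 - k%:P * 'X ^+ 2) + (2 * S i j)%:P * 'X
  + (2 * (S *m S) i j)%:P * 'X ^+ 2.
have cE s i j : (c i j).[s] = cayley S k s i j.
  by rewrite /c !(hornerXn, hornerD, hornerN, hornerM, hornerC, hornerX) cayleyE mxE; ring.
have dc i j : (c i j)^`().[0] = 2 * S i j.
  rewrite /c !(derivD, derivN, derivM, derivC, derivX, derivXn).
  by rewrite !(hornerXn, hornerD, hornerN, hornerM, hornerC, hornerX, hornerMn) /=; ring.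
have c0 i j : (c i j).[0] = (i == j)%:R.
  by rewrite /c !(hornerXn, hornerD, hornerN, hornerM, hornerC, hornerX); ring.
exists (\sum_j (\sum_i c i u * (M i j)%:P) * c j v).
  move=> s; rewrite mxE horner_sum; apply: eq_bigr => j _; rewrite hornerM cE; congr (_ * _).
  rewrite [in RHS]mxE horner_sum; apply: eq_bigr => i _; rewrite hornerM cE hornerC; congr (_ * _).
  by rewrite [RHS]mxE.
split.
  rewrite horner_sum; transitivity (\sum_j (v == j)%:R * M u j); last by rewrite sum_pick.
  apply: eq_bigr => j _; rewrite hornerM c0 mulrC (eq_sym v); congr (_ * _).
  rewrite horner_sum; transitivity (\sum_i (u == i)%:R * M i j); last by rewrite sum_pick.
  by apply: eq_bigr => i _; rewrite hornerM c0 hornerC (eq_sym u).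
rewrite linear_sum /= horner_sum.
transitivity (\sum_j ((v == j)%:R * (2 * (S^T *m M) u j) + 2 * (M u j * S j v))).
  apply: eq_bigr => j _; rewrite derivM hornerD !hornerM dc c0 mulrC (eq_sym v).
  congr (_ * _ + _).
    rewrite linear_sum /= horner_sum mxE mulr_sumr; apply: eq_bigr => i _.
    by rewrite derivM derivC mulr0 addr0 hornerM dc hornerC mxE mulrA.
  rewrite mulrCA; congr (_ * (_ * _)); rewrite horner_sum.
  transitivity (\sum_i (u == i)%:R * M i j); last by rewrite sum_pick.
  by apply: eq_bigr => i _; rewrite hornerM c0 hornerC (eq_sym u).
rewrite big_split /= sum_pick // -mulr_sumr [in RHS]mxE mulrDr.
by congr (_ + 2 * _); rewrite [RHS]mxE.
Qed.

Hypothesis isometry_act : forall h x, gauge h -> exists y, forall l, Y l y = h^T *m Y l x *m h.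

Lemma sum_slots (F : A -> K) : \sum_a F a = \sum_k (F (k, false) + F (k, true)).
Proof.
transitivity (\sum_(k < d) \sum_(b : bool) F (k, b)).
  by rewrite pair_bigA; apply: eq_bigr => -[].
by apply: eq_bigr => k _; rewrite big_bool addrC.
Qed.

(* Derivative at [s = 0] of the invariance under the Cayley curve of [skew_mx u v]. *)
Lemma skew_word_sum_eq0 u v t x : gr u = gr v -> gr u != gr star ->
  isometry_invariant (tensor_val t) ->
  \sum_c t c * \sum_a skew_slot u v a (word c.1 x) c.2 = 0.
Proof.
move=> uv us invt; have [k S3] := skew_mx_cubic sgK ep_sg uv.
set S := skew_mx u v in S3.
have /choice[F HF] (lij : L * 'I_N * 'I_N) : exists F : {poly K},
    [/\ forall s, F.[s] = ((cayley S k s)^T *m Y lij.1.1 x *m cayley S k s) lij.1.2 lij.2,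
      F.[0] = Y lij.1.1 x lij.1.2 lij.2 &
      F^`().[0] = 2 * (S^T *m Y lij.1.1 x + Y lij.1.1 x *m S) lij.1.2 lij.2].
  have [P HP [P0 dP]] := horner_deriv_cayley_form S (Y lij.1.1 x) k lij.1.2 lij.2.
  by exists P.
pose G (c : tensor_index) j := F (c.1 j, c.2 (j, false), c.2 (j, true)).
pose Q := \sum_c (t c)%:P * \prod_j G c j.
pose D : {poly K} := 1 - k%:P * 'X ^+ 2.
have DE s : D.[s] = 1 - k * s ^+ 2 by rewrite /D !(hornerXn, hornerD, hornerN, hornerM, hornerC).
(* Each of the [d] letters is multiplied on both sides by a normalised Cayley matrix, hence [2 d]
   factors of the denominator. *)
have QE s : D.[s] != 0 -> Q.[s] = D.[s] ^+ (2 * d) * tensor_val t x.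
  rewrite DE => Ds; have gh := gauge_cayley gr_sg sgK ep_sg uv us S3 Ds;
    have [y Hy] := isometry_act x gh.
  rewrite -(invt _ _ _ gh Hy) /Q /tensor_val horner_sum mulr_sumr; apply: eq_bigr => c _.
  rewrite hornerM hornerC mulrCA; congr (_ * _); rewrite horner_prod.
  rewrite /word exprM -[X in _ ^+ X](card_ord d) -prodr_const -big_split.
  apply: eq_bigr => j _ /=; have [FE _ _] := HF (c.1 j, c.2 (j, false), c.2 (j, true)).
  rewrite /= Hy [(_ *: _)^T]linearZ /= -!scalemxAl -scalemxAr scalerA [X in _ * X]mxE mulrA.
  rewrite -[_^-1 * _^-1]expr2 -exprMn mulfV // expr1n mul1r; exact: FE.
(* Multiplying the difference by [D] makes it vanish also at the zeros of [D], so the identity of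
   values becomes one of polynomials. *)
have {}QE : Q = D ^+ (2 * d) * (tensor_val t x)%:P.
  have D0 : D != 0.
    by apply/eqP => D0; have := DE 0; rewrite D0 horner0 expr0n mulr0 subr0 => /eqP;
      rewrite eq_sym oner_eq0.
  apply/eqP; rewrite -subr_eq0 -(mulIr_eq0 _ (mulIf D0)); apply/eqP/poly_eq0_horner => s.
  rewrite hornerM; have [->|Ds] := eqVneq D.[s] 0; first exact: mulr0.
  by rewrite hornerD hornerN hornerM horner_exp hornerC QE // subrr mul0r.
(* [D] is a polynomial in the square of the variable, so its derivative vanishes at 0. *)
have dQ0 : Q^`().[0] = 0.
  rewrite QE derivM derivC mulr0 addr0 hornerM deriv_exp hornerMn hornerM.
  rewrite /D !(derivD, derivN, derivM, derivC, derivXn).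
  by rewrite !(hornerX, hornerXn, hornerD, hornerN, hornerM, hornerC, hornerMn) !(mulr0, mul0r,
    addr0, oppr0, mul0rn).
apply/eqP; rewrite -(mulrI_eq0 _ (mulfI (_ : 2 != 0 :> K))) ?pnatr_eq0 //; apply/eqP.
rewrite -[RHS]dQ0 /Q linear_sum /= horner_sum mulr_sumr; apply: eq_bigr => c _.
rewrite derivM derivC mul0r add0r hornerM hornerC mulrCA; congr (_ * _).
rewrite deriv_prod horner_sum sum_slots mulr_sumr; apply: eq_bigr => j _.
rewrite skew_slot_word hornerM horner_prod -/S.
have [_ _ ->] := HF (c.1 j, c.2 (j, false), c.2 (j, true)).
rewrite mulrA; congr (_ * _); apply: eq_bigr => i _.
by have [_ -> _] := HF (c.1 i, c.2 (i, false), c.2 (i, true)).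
Qed.

Definition mirror_tensor p t : tensor_index -> K :=
  fun c => (-1) ^+ #|[set a | c.2 a == p]| * t c.

Lemma mirror_tensor_val p t x : gr p != gr star -> ~~ dl (gr p) ->
  isometry_invariant (tensor_val t) -> tensor_val (mirror_tensor p t) x = tensor_val t x.
Proof.
move=> ps dp invt; have gm := gauge_mirror ep sgK sg_id ps dp.
have [y Hy] := isometry_act x gm.
rewrite -(invt _ _ _ gm Hy); apply: eq_bigr => c _.
rewrite /mirror_tensor mulrAC mulrC; congr (_ * _).
have -> : (-1) ^+ #|[set a | c.2 a == p]| = \prod_a (-1) ^+ (c.2 a == p) :> K.
  rewrite -prodr_const [RHS](bigID (fun a => c.2 a == p)) /= [X in _ = _ * X]big1 ?mulr1.
    by apply: eq_big => a; rewrite inE // => ->; rewrite expr1.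
  by move=> a /negPf->; rewrite expr0.
transitivity (\prod_(k < d) \prod_(b : bool) (-1) ^+ (c.2 (k, b) == p) * word c.1 x c.2).
  by rewrite pair_bigA; congr (_ * _); apply: eq_bigr => -[].
rewrite /word -big_split; apply: eq_bigr => k _ /=.
by rewrite Hy mirror_trE big_bool /= [X in X * _]mulrC.
Qed.

Lemma conj_ep p : (ep p)^* = ep p.
Proof.
have /eqP : ep p ^+ 2 = 1 by rewrite expr2.
by rewrite sqrf_eq1 => /orP[] /eqP->; rewrite ?rmorphN rmorph1.
Qed.

Lemma conj_skew_slot u v a (f : {ffun A -> 'I_N} -> K) e :
  (skew_slot u v a f e)^* = skew_slot u v a (fun e => (f e)^*) e.
Proof. by rewrite /skew_slot rmorphB !rmorphM rmorph_sign !rmorph_nat /= !conj_ep. Qed.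

Local Notation contracts := (contracts gr sg ep).

Lemma conj_contracts mu (f : {ffun A -> 'I_N} -> K) e :
  (contracts mu f e)^* = contracts mu (fun e => (f e)^*) e.
Proof.
elim: mu f => //= o mu IHmu f; rewrite IHmu; apply: eq_contracts => e'.
by rewrite /contract rmorph_sum; apply: eq_bigr => p _; rewrite rmorphM /= conj_ep.
Qed.

Variables (good : (X -> 'I_N -> 'I_N -> K) -> Prop) (R : (X -> K) -> Prop).
Hypothesis good_Y : forall l, good (fun x => Y l x).
Hypothesis good_flip : forall Z, good Z -> good (flip Z).
Hypothesis good_comp : forall i Z Z', good Z -> good Z' -> good (form_comp gr sg ep i Z Z').
Hypothesis good_trace : forall i Z, good Z -> R (form_trace gr sg ep i Z).
Hypothesis R_cst : forall a, R (fun=> a).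
Hypothesis RD : forall r s, R r -> R s -> R (fun x => r x + s x).
Hypothesis RM : forall r s, R r -> R s -> R (fun x => r x * s x).
Hypothesis R_invariant : forall r, R r -> isometry_invariant r.

(** Each position [k] becomes a letter on the slots [(k, false)] and [(k, true)]; these letters use
    every slot exactly once. *)
Lemma contracts_word_val mu w e : perm_eq (slots mu) (enum [set: A]) ->
  R (fun x => contracts mu (word w x) e).
Proof.
pose ls := [seq (fun x => Y (w k) x : 'I_N -> 'I_N -> K, (k, false), (k, true)) | k <- enum 'I_d].
have mem_ls a : a \in letter_slots ls.
  apply/flattenP; case: a => k b; exists [:: (k, false); (k, true)]; last by case: b;
    rewrite !inE eqxx ?orbT.
  rewrite -map_comp; apply/mapP; exists k => //; exact: mem_enum.
have size_ls : size (letter_slots ls) = #|{: A}|.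
  rewrite card_prod card_bool card_ord -[in RHS](size_enum_ord d) /ls.
  by elim: (enum 'I_d) => //= k s ->.
have uls : uniq (letter_slots ls).
  apply: (leq_size_uniq (enum_uniq (mem {: A}))) => [a _|]; first exact: mem_ls.
  by rewrite size_ls -cardE.
have gls : good_letters good ls by rewrite /ls; elim: (enum 'I_d) => //= k s IHs.
move=> Hmu; have [|r Rr Hr] := contracts_word good_flip good_comp good_trace (R_cst 1) RM gls uls
  (mu := mu).
  rewrite (perm_trans Hmu) //; apply: uniq_perm => //; first exact: enum_uniq.
  by move=> a; rewrite mem_ls mem_enum inE.
rewrite (_ : (fun=> _) = r) //; apply/funext => x; rewrite -(Hr x e).
apply: eq_contracts => e'; rewrite /word_val big_map big_enum //.
Qed.

Lemma tensor_valB (s t : tensor_index -> K) x :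
  tensor_val (fun c => t c - s c) x = tensor_val t x - tensor_val s x.
Proof. by rewrite /tensor_val -sumrB; apply: eq_bigr => c _; rewrite mulrBl. Qed.

(** Moving the Lie operator from the tensor to the word replaces [u], [v] by [sg v], [sg u], again a
    pair in one block away from [star]. *)
Lemma tensor_val_skew u v t x : gr u = gr v -> gr u != gr star ->
  isometry_invariant (tensor_val t) -> tensor_val (skew_tensor u v t) x = 0.
Proof.
move=> uv us invt; rewrite /tensor_val (skew_tensor_adj t (fun c => word c.1 x c.2) uv).
have vu : gr (sg v) = gr (sg u) by rewrite !gr_sg uv.
have vs : gr (sg v) != gr star by rewrite gr_sg -uv.
by rewrite [X in _ * X](skew_word_sum_eq0 x vu vs invt) mulr0.
Qed.

Lemma sum_normsq_eq0 (s : tensor_index -> K) : \sum_c s c * (s c)^* = 0 -> forall c, s c = 0.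
Proof.
move=> s0 c; apply/eqP; rewrite -mul_conjC_eq0; apply/eqP; apply: (psumr_eq0P _ s0) => //.
by move=> c' _; exact: mul_conjC_ge0.
Qed.

Theorem isometry_invariant_val t : isometry_invariant (tensor_val t) -> R (tensor_val t).
Proof.
move=> invt; pose U (s : tensor_index -> K) := R (tensor_val s).
have U0 : U (fun=> 0).
  rewrite /U (_ : tensor_val _ = fun=> 0); first exact: R_cst.
  by apply/funext => x; rewrite /tensor_val big1 // => c _; rewrite mul0r.
have UL a s s' : U s -> U s' -> U (fun c => a * s c + s' c).
  move=> Us Us'; rewrite /U (_ : tensor_val _ = fun x => a * tensor_val s x + tensor_val s' x).
    by apply: RD => //; apply: RM => //; exact: R_cst.
  apply/funext => x; rewrite /tensor_val mulr_sumr -big_split; apply: eq_bigr => c _ /=.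
  by rewrite mulrDl mulrA.
have [u Uu ort] := ortho_projection U0 UL t.
pose r c := t c - u c.
have invr : isometry_invariant (tensor_val r).
  move=> h x y gh Hy; rewrite !tensor_valB (invt _ _ _ gh Hy).
  by rewrite (R_invariant Uu gh Hy).
have N0 s : tensor_val s = (fun=> 0) -> \sum_c r c * (s c)^* = 0.
  by move=> s0; apply: ort; rewrite /U s0; exact: R_cst.
(* With [S] the Lie operator and [S'] its adjoint, the squared norm of [S r] is the product of [r]
   with [S' S r]. The value of [S r] is zero, hence isometry invariant, so [S' S r] also has value
   zero, and [r] is orthogonal to it. *)
have skew0 v v' c : gr v = gr v' -> gr v != gr star -> skew_tensor v v' r c = 0.
  move=> vv' vs; move: c; apply: sum_normsq_eq0.
  rewrite skew_tensor_adj //; rewrite [X in _ * X](_ : _ = 0) ?mulr0 //.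
  rewrite -[RHS](N0 (skew_tensor (sg v') (sg v) (skew_tensor v v' r))).
    apply: eq_bigr => c _; congr (_ * _); rewrite rmorph_sum; apply: eq_bigr => a _.
    by rewrite /= conj_skew_slot.
  apply/funext => x; apply: tensor_val_skew => [||h x' y _ _]; rewrite ?gr_sg -?vv' //.
  by rewrite !tensor_val_skew.
(* Let [M] be the sign change and [n = M r - r]. As [M] is self-adjoint, the squared norm of [n] is
   the product of [r] with [M n - n], a tensor of value zero. *)
have mirror0 p c : gr p != gr star -> ~~ dl (gr p) -> mirror_tensor p r c = r c.
  move=> ps dp; apply/eqP; rewrite -subr_eq0; apply/eqP; move: c.
  apply: (sum_normsq_eq0 (s := fun c => mirror_tensor p r c - r c)).
  pose n c := mirror_tensor p r c - r c.
  have n0 : tensor_val n = (fun=> 0).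
    by apply/funext => x; rewrite tensor_valB mirror_tensor_val // subrr.
  pose mn c := mirror_tensor p n c - n c.
  have mn0 : tensor_val mn = (fun=> 0).
    by apply/funext => x; rewrite tensor_valB mirror_tensor_val // ?n0 // subrr.
  rewrite -[RHS](N0 mn mn0); apply: eq_bigr => c _.
  by rewrite /mn /n /mirror_tensor !(rmorphB, rmorphM, rmorph_sign) /=; ring.
have r0 c : r c = 0.
  case: c => w; apply: (inv_eq0 gr_sg sgK ep2 ep_sg sg_id gr_star dl_star (S := [set: A])).
  - by rewrite cardsT card_prod card_bool muln2 odd_double.
  - move=> v v' e vv' vs; rewrite -[RHS](skew0 v v' (w, e) vv' vs).
    by apply: eq_bigl => a; rewrite inE.
  - move=> p e ps dp; have := mirror0 p (w, e) ps dp.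
    rewrite /mirror_tensor (eq_card (B := [set a in [set: A] | e a == p])); last first.
      by move=> a; rewrite !inE.
    move=> /[swap]; rewrite -signr_odd => ->; rewrite expr1 mulN1r => /eqP.
    by rewrite eq_sym -addr_eq0 -mulr2n mulrn_eq0 => /eqP.
  (* [B] holds the coefficients of the contraction [mu] on the word [w]. Its value is the contracted
     word, so [B] lies in [U]; as these coefficients are real, orthogonality of [r] to [B] says that
     the contraction of [r] vanishes. *)
  - move=> mu Hmu e; pose b e' : K := contracts mu (fun e1 => (e1 == e')%:R) e.
    pose B (c : tensor_index) : K := (c.1 == w)%:R * b c.2.
    have UB : U B.
      rewrite /U (_ : tensor_val B = fun x => contracts mu (word w x) e);
        first exact: contracts_word_val.
      apply/funext => x; rewrite /tensor_val sum_index (bigD1 w) //= [X in _ + X]big1 ?addr0;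
        last first.
        by move=> w' /negPf ww'; rewrite big1 // => e' _; rewrite /B ww' !mul0r.
      under eq_bigr do rewrite /B eqxx mul1r mulrC.
      rewrite -contracts_sum; apply: eq_contracts => e'.
      by rewrite (bigD1 e') //= eqxx mulr1 big1 ?addr0 // => e1 /negPf ne; rewrite eq_sym ne mulr0.
    rewrite -[RHS](ort B UB) sum_index (bigD1 w) //= [X in _ + X]big1 ?addr0; last first.
      by move=> w' /negPf ww'; rewrite big1 // => e' _; rewrite /B ww' mul0r rmorph0 mulr0.
    rewrite (eq_bigr (fun e' => r (w, e') * b e')); last first.
      move=> e' _; rewrite /B eqxx mul1r /b conj_contracts; congr (_ * _).
      by apply: eq_contracts => e1; rewrite rmorph_nat.
    rewrite /b -contracts_sum; apply: eq_contracts => e'.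
    by rewrite (bigD1 e') //= eqxx mulr1 big1 ?addr0 // => e1 /negPf ne; rewrite eq_sym ne mulr0.
rewrite (_ : t = u) //; apply/funext => c; apply/eqP; rewrite -subr_eq0; exact/eqP/r0.
Qed.

End Tensors.

(** * Normal form of a bilinear form *)

Section Darboux.
Variables (K : numClosedFieldType) (U : vectType K) (d : bool).
Variable b : {hermitian U for d & idfun}.
Hypothesis nb : nondegenerate b.

(* The Gram matrix is asked to be real monomial so that the Lie algebra of the isometry group
   is stable under conjugate transposition in these coordinates. *)
Record darboux := Darboux {
  dx :> finType;
  dvec : dx -> U;
  dsg : dx -> dx;
  dep : dx -> K;
  dsgK : involutive dsg;
  dep2 : forall p, dep p * dep p = 1;
  dep_sg : forall p, dep (dsg p) = (-1) ^+ d * dep p;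
  dsg_id : ~~ d -> forall p, dsg p = p;
  dgram : forall p q, b (dvec p) (dvec q) = dep p * (q == dsg p)%:R
}.

(** The vector dual to [dvec p] is [dvec (dsg p)], up to the sign [dep (dsg p)]. *)
Definition dcoord (B : darboux) (p : B) (x : U) : K := dep (dsg p) * b (dvec (dsg p)) x.

Definition dproj (B : darboux) (x : U) : U := \sum_p dcoord p x *: dvec (p : B).

Lemma formB x y z : b z (x - y) = b z x - b z y.
Proof. by rewrite -scaleN1r addrC formPr mulN1r addrC. Qed.

Lemma formZ a x z : b z (a *: x) = a * b z x.
Proof. by rewrite -[a *: x]addr0 formPr linear0r addr0. Qed.

Lemma formZl a x z : b (a *: x) z = a * b x z.
Proof. by rewrite -[a *: x]addr0 formPl linear0l addr0. Qed.

Lemma form_sumr (T : finType) (F : T -> U) z : b z (\sum_p F p) = \sum_p b z (F p).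
Proof.
apply: (big_morph (b z)) => [x y|]; last exact: linear0r.
by rewrite -[x]scale1r formPr mul1r scale1r.
Qed.

Lemma formC x y : b x y = (-1) ^+ d * b y x.
Proof. exact: hermC. Qed.

Lemma dcoord_sum (B : darboux) (c : B -> K) p : dcoord p (\sum_q c q *: dvec q) = c p.
Proof.
rewrite /dcoord form_sumr.
transitivity (\sum_q (p == q)%:R * (dep (dsg p) * dep (dsg p) * c q)).
  rewrite mulr_sumr; apply: eq_bigr => q _.
  by rewrite formZ dgram dsgK (eq_sym p); ring.
by rewrite sum_pick // dep2 mul1r.
Qed.

Lemma dproj_ortho (B : darboux) (p : B) x : b (dvec p) (x - dproj B x) = 0.
Proof.
have /eqP := dcoord_sum (fun q : B => dcoord q x) (dsg p).
rewrite -/(dproj B x) /dcoord dsgK -subr_eq0 -mulrBr mulf_eq0 => /orP[/eqP e0|].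
  by have /eqP := dep2 p; rewrite e0 mul0r eq_sym oner_eq0.
by rewrite -formB -opprB -scaleN1r formZ mulf_eq0 oppr_eq0 oner_eq0 => /eqP.
Qed.

Lemma card_darboux (B : darboux) : (#|B| <= \dim {:U})%N.
Proof.
pose X := [tuple dvec (enum_val i) | i < #|B|].
suff fX : free X by rewrite -(size_tuple X) -(eqP fX) dimvS // subvf.
apply/freeP => k k0 i; have := dcoord_sum (fun p : B => k (enum_rank p)) (enum_val i).
rewrite enum_valK => <-; rewrite [X in dcoord _ X](_ : _ = 0).
  by rewrite /dcoord linear0r mulr0.
rewrite -[RHS]k0 (reindex (fun j : 'I_#|B| => enum_val j)) /=;
  last exact: onW_bij (@enum_val_bij B).
by apply: eq_bigr => j _; rewrite enum_valK (nth_map j) ?size_enum_ord // nth_ord_enum.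
Qed.

Lemma darboux0 : exists B : darboux, #|B| = 0%N.
Proof.
have v (p : void) : false by case: p.
by exists (@Darboux void (fun=> 0) id (fun=> 0) (fun=> erefl)
   (fun p => match v p with end) (fun p => match v p with end) (fun _ p => erefl)
   (fun p q => match v p with end)); rewrite card_void.
Qed.

Lemma formC0 x y : b x y = 0 -> b y x = 0.
Proof. by move=> xy; rewrite formC xy mulr0. Qed.

Lemma darboux_extend_sym (B : darboux) v : ~~ d -> b v v = 1 ->
  (forall p : B, b (dvec p) v = 0) -> exists B' : darboux, #|B'| = #|B|.+1.
Proof.
move=> d0 vv Bv.
pose vec (o : option B) := if o is Some p then dvec p else v.
pose sg (o : option B) := if o is Some p then Some (dsg p) else None.
pose ep (o : option B) := if o is Some p then dep p else 1.
have sgK : involutive sg by case=> //= p; rewrite dsgK.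
have ep2 o : ep o * ep o = 1 by case: o => /= [p|]; rewrite ?dep2 ?mulr1.
have ep_sg o : ep (sg o) = (-1) ^+ d * ep o.
  by case: o => /= [p|]; rewrite ?dep_sg // (negPf d0) mul1r.
have sg_id : ~~ d -> forall o, sg o = o.
  by move=> _ [p|] //=; rewrite dsg_id.
have gram p q : b (vec p) (vec q) = ep p * (q == sg p)%:R.
  case: p q => [p|] [q|] /=; rewrite ?dgram ?Bv ?(formC0 (Bv _)) ?mulr0 ?mulr1 //.
by exists (Darboux sgK ep2 ep_sg sg_id gram); rewrite card_option.
Qed.

Lemma darboux_extend_alt (B : darboux) u v : d -> b u v = 1 -> b u u = 0 -> b v v = 0 ->
  (forall p : B, b (dvec p) u = 0) -> (forall p : B, b (dvec p) v = 0) ->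
  exists B' : darboux, #|B'| = #|B|.+2.
Proof.
move=> d1 uv uu vv Bu Bv.
pose w (c : bool) := if c then v else u.
have Bw c (p : B) : b (dvec p) (w c) = 0 by case: c.
have ww c c' : b (w c) (w c') = (-1) ^+ c * (c' == ~~ c)%:R.
  case: c c' => [] [] /=; rewrite ?uu ?vv ?mulr0 ?uv ?mulr1 //.
  by rewrite formC uv d1 mulr1.
pose vec (o : B + bool) := match o with inl p => dvec p | inr c => w c end.
pose sg (o : B + bool) : B + bool := match o with inl p => inl (dsg p) | inr c => inr (~~ c) end.
pose ep (o : B + bool) : K := match o with inl p => dep p | inr c => (-1) ^+ c end.
have sgK : involutive sg by case=> /= [p|c]; rewrite ?dsgK ?negbK.
have ep2 o : ep o * ep o = 1 by case: o => /= [p|c]; rewrite ?dep2 // -expr2 sqrr_sign.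
have ep_sg o : ep (sg o) = (-1) ^+ d * ep o.
  by case: o => /= [p|[]]; rewrite ?dep_sg // d1 /=; ring.
have sg_id : ~~ d -> forall o, sg o = o by rewrite d1.
have gram p q : b (vec p) (vec q) = ep p * (q == sg p)%:R.
  by case: p q => [p|c] [q|c'] /=; rewrite ?dgram ?Bw ?ww ?(formC0 (Bw _ _)) ?mulr0.
by exists (Darboux sgK ep2 ep_sg sg_id gram); rewrite card_sum card_bool addn2.
Qed.

(** The form pairs some [y] and [z] of the orthogonal complement nontrivially. An alternating form
    gives a hyperbolic pair after scaling [z]; for a symmetric form one of [y], [z], [y + z] is
    anisotropic and is normalised by a square root. *)
Lemma darboux_extend (B : darboux) : ~ (forall x, x = dproj B x) ->
  exists B' : darboux, (#|B| < #|B'|)%N.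
Proof.
move=> /existsNP[x xB]; pose y := x - dproj B x.
have y0 : y <> 0 by move/eqP; rewrite subr_eq0 => /eqP.
have By (p : B) : b (dvec p) y = 0 by exact: dproj_ortho.
have [z0 yz0] : exists z, b z y <> 0.
  by apply/existsNP => y00; apply: y0; exact: (nondeg_inj nb).
pose z := z0 - dproj B z0.
have Bz (p : B) : b (dvec p) z = 0 by exact: dproj_ortho.
have yz : b y z <> 0.
  move=> yz; apply: yz0; rewrite formC -[X in b y X](subrK (dproj B z0)) -/z.
  rewrite -[z]scale1r formPr mul1r yz add0r form_sumr big1 ?mulr0 // => p _.
  by rewrite formZ (formC0 (By p)) mulr0.
have two0 : 2 != 0 :> K by rewrite pnatr_eq0.
have [d1|d0] := boolP d.
  have sd : (-1) ^+ d = -1 :> K by rewrite d1.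
  have alt v : b v v = 0.
    have /eqP := formC v v; rewrite sd mulN1r -addr_eq0 -mulr2n -mulr_natl.
    by rewrite mulf_eq0 (negPf two0) => /eqP.
  have [|||||B' cB'] := @darboux_extend_alt B y ((b y z)^-1 *: z) d1; rewrite ?alt //.
  - by rewrite formZ mulVf //; exact/eqP.
  - by move=> p; rewrite formZ Bz mulr0.
  - by exists B'; rewrite cB'.
have sd : (-1) ^+ d = 1 :> K by rewrite (negPf d0).
have [v [Bv vv]] : exists v, (forall p : B, b (dvec p) v = 0) /\ b v v <> 0.
  have [yy|yy] := eqVneq (b y y) 0; last by exists y; split=> //; exact/eqP.
  have [zz|zz] := eqVneq (b z z) 0; last by exists z; split=> //; exact/eqP.
  exists (1 *: y + z); split=> [p|]; first by rewrite formPr By Bz mulr0 addr0.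
  rewrite formPr !formPl !mul1r yy zz add0r addr0 [b z y]formC sd mul1r -mulr2n -mulr_natl.
  by move/eqP; rewrite mulf_eq0 (negPf two0) => /eqP.
have s0 : sqrtC (b v v) != 0 by rewrite sqrtC_eq0; exact/eqP.
have [|p|B' cB'] := @darboux_extend_sym B ((sqrtC (b v v))^-1 *: v) d0.
- rewrite formZ (formC (_ *: _)) formZ sd mul1r mulrA -expr2 exprVn sqrtCK mulVf //; exact/eqP.
- by rewrite formZ Bv mulr0.
by exists B'; rewrite cB'.
Qed.

Lemma darboux_basis : exists B : darboux, forall x, x = dproj B x.
Proof.
suff H n (B : darboux) : (\dim {:U} - #|B| < n)%N -> exists B' : darboux, forall x, x = dproj B' x.
  by have [B _] := darboux0; exact: (H _ B (ltnSn _)).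
elim: n B => // n IHn B ltn.
have [|nB] := pselect (forall x, x = dproj B x); first by exists B.
have [B' BB'] := darboux_extend nB; apply: (IHn B').
have := card_darboux B; have := card_darboux B'; lia.
Qed.

End Darboux.

(** * Matrices of block operators *)

Definition lfun_of (K : fieldType) (U U' : vectType K) (f : U -> U') (f_lin : linear f) : 'Hom(U,
  U') :=
  linfun (HB.pack_for {linear U -> U'} f (GRing.isLinear.Build _ _ _ _ f f_lin)).

Lemma lfun_ofE (K : fieldType) (U U' : vectType K) (f : U -> U') (f_lin : linear f) x :
  lfun_of f_lin x = f x.
Proof. by rewrite lfunE. Qed.

Section Frame.
Variables (K : numClosedFieldType) (J : finType) (V : J -> vectType K) (d : J -> bool).
Variables (f : forall j, {hermitian (V j) for d j & idfun}) (B : forall j, darboux (f j)).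
Hypothesis B_basis : forall j x, x = dproj (B j) x.

Definition frame_index : finType := {j : J & B j}.
Local Notation N := #|frame_index|.
Implicit Types (i j k : J) (u v p q : 'I_N).

Definition fgr u : J := tag (enum_val u : frame_index).
Definition fsg u : 'I_N :=
  enum_rank (Tagged (fun j => B j) (dsg (tagged (enum_val u : frame_index)))).
Definition fep u : K := dep (tagged (enum_val u : frame_index)).

(** Written as a sum of Kronecker deltas so that it lies in [V j] for every index [u], with value
    zero outside the block and no transport along [fgr u = j]. *)
Definition fvec j u : V j :=
  \sum_(p : B j) ((enum_val u : frame_index) == Tagged (fun j => B j) p)%:R *: dvec p.

Definition fcoord j u (x : V j) : K := fep (fsg u) * f j (fvec j (fsg u)) x.

Local Notation gram := (gram fsg fep).

Lemma enum_val_fsg u :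
  enum_val (fsg u) = Tagged (fun j => B j) (dsg (tagged (enum_val u : frame_index))).
Proof. by rewrite enum_rankK. Qed.

Lemma fgr_sg u : fgr (fsg u) = fgr u.
Proof. by rewrite /fgr enum_val_fsg. Qed.

Lemma fsgK : involutive fsg.
Proof.
move=> u; apply: enum_val_inj; rewrite !enum_val_fsg /= dsgK.
by case: (enum_val u).
Qed.

Lemma fep2 u : fep u * fep u = 1.
Proof. exact: dep2. Qed.

Lemma fep_sg u : fep (fsg u) = (-1) ^+ d (fgr u) * fep u.
Proof. by rewrite /fep /fgr enum_val_fsg /= dep_sg. Qed.

Lemma fsg_id u : ~~ d (fgr u) -> fsg u = u.
Proof.
move=> du; apply: enum_val_inj; rewrite enum_val_fsg.
by move: du; rewrite /fgr; case: (enum_val u) => j p /= dj; rewrite dsg_id.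
Qed.

Lemma fvecE j (p : B j) : fvec j (enum_rank (Tagged (fun j => B j) p)) = dvec p.
Proof.
rewrite /fvec enum_rankK (bigD1 p) //= eqxx scale1r big1 ?addr0 // => q qp.
by rewrite eq_Tagged /= eq_sym (negPf qp) scale0r.
Qed.

Lemma frame_indexP u j : fgr u = j -> exists p : B j, u = enum_rank (Tagged (fun j => B j) p).
Proof.
rewrite /fgr => <-; exists (tagged (enum_val u : frame_index)).
by apply: enum_val_inj; rewrite enum_rankK; case: (enum_val u).
Qed.

Lemma fvec0 j u : fgr u != j -> fvec j u = 0.
Proof.
move=> uj; rewrite /fvec big1 // => p _; case: eqP => [up|]; last by rewrite scale0r.
by rewrite /fgr up eqxx in uj.
Qed.

Lemma fvec_gram j u v : f j (fvec j u) (fvec j v) = (fgr u == j)%:R * gram u v.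
Proof.
have [uj|uj] := eqVneq (fgr u) j; last by rewrite fvec0 // linear0l mul0r.
have [vj|vj] := eqVneq (fgr v) j; last first.
  rewrite [fvec j v]fvec0 // linear0r mul1r mxE; case: eqP => [vu|]; last by rewrite mulr0.
  by rewrite vu fgr_sg uj eqxx in vj.
have [p ->] := frame_indexP uj; have [q ->] := frame_indexP vj.
rewrite !fvecE dgram mul1r mxE /fep /fsg !enum_rankK /=; congr (_ * (nat_of_bool _)%:R).
by rewrite (inj_eq enum_rank_inj) eq_Tagged.
Qed.

Lemma fcoord_lin j u : scalar (fcoord u : V j -> K).
Proof. by move=> a x y; rewrite /fcoord formPr; ring. Qed.

Lemma fcoordZ j u a (x : V j) : fcoord u (a *: x) = a * fcoord u x.
Proof. by rewrite /fcoord formZ mulrCA. Qed.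

Lemma fcoordD j u (x y : V j) : fcoord u (x + y) = fcoord u x + fcoord u y.
Proof. by have := fcoord_lin u 1 x y; rewrite scale1r mul1r. Qed.

Lemma fcoord_sumr j u (T : finType) (F : T -> V j) :
  fcoord u (\sum_t F t) = \sum_t fcoord u (F t).
Proof. by rewrite /fcoord form_sumr mulr_sumr. Qed.

Lemma fcoord_vec j u v : fcoord u (fvec j v) = ((fgr u == j) && (u == v))%:R.
Proof.
rewrite /fcoord fvec_gram mxE fsgK fgr_sg (eq_sym v) -mulnb natrM.
rewrite mulrCA [X in _ * X]mulrA fep2 mul1r //.
Qed.

Lemma fcoord0 j u (x : V j) : fgr u != j -> fcoord u x = 0.
Proof. by move=> uj; rewrite /fcoord fvec0 ?fgr_sg // linear0l mulr0. Qed.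

Lemma fcoord_sum j (x : V j) : x = \sum_u fcoord u x *: fvec j u.
Proof.
rewrite [LHS]B_basis.
transitivity (\sum_u \sum_(p : B j) ((enum_val u : frame_index) == Tagged (fun j => B j) p)%:R
    * fcoord u x *: dvec p).
  rewrite exchange_big /=; apply: eq_bigr => p _.
  rewrite (bigD1 (enum_rank (Tagged (fun j => B j) p))) //= enum_rankK eqxx mul1r big1 ?addr0.
    rewrite /fcoord /dcoord {1}/fep /fsg enum_rankK /= enum_rankK /= fvecE //.
  move=> u up; case: eqP => [E|]; last by rewrite mul0r scale0r.
  by rewrite -E enum_valK eqxx in up.
apply: eq_bigr => u _; rewrite /fvec scaler_sumr; apply: eq_bigr => p _.
by rewrite scalerA mulrC.
Qed.

Lemma form_expand j (x y : V j) : f j x y =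
  \sum_u \sum_v fcoord u x * fcoord v y * f j (fvec j u) (fvec j v).
Proof.
rewrite {1}(fcoord_sum y) form_sumr exchange_big; apply: eq_bigr => v _ /=.
rewrite formZ (formC _ x) {1}(fcoord_sum x) form_sumr mulr_sumr mulr_sumr; apply: eq_bigr => u _.
by rewrite formZ (formC _ (fvec j u)); ring.
Qed.

Lemma lfun_frame_eq i (U : vectType K) (S T : 'Hom(V i, U)) :
  (forall u, S (fvec i u) = T (fvec i u)) -> S = T.
Proof.
move=> E; apply/lfunP => x; rewrite (fcoord_sum x) !linear_sum; apply: eq_bigr => u _.
by rewrite !linearZ /= E.
Qed.

(** Form matrices transform by congruence under isometries, while the operator matrices [opmx]
    transform by conjugation. *)
Definition formmx i j (T : 'Hom(V i, V j)) : 'M[K]_N :=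
  \matrix_(u, v) f j (T (fvec i u)) (fvec j v).

Definition opmx i j (T : 'Hom(V i, V j)) : 'M[K]_N :=
  \matrix_(u, v) fcoord u (T (fvec i v)).

Lemma formmx_op i j (T : 'Hom(V i, V j)) : formmx T = (opmx T)^T *m gram.
Proof.
apply/matrixP => u v; rewrite [LHS]mxE [RHS]mxE {1}(fcoord_sum (T _)) formC form_sumr mulr_sumr.
apply: eq_bigr => p _; rewrite formZ mulrCA -formC fvec_gram [(opmx T)^T _ _]mxE [opmx T _ _]mxE.
by have [pj|pj] := eqVneq (fgr p) j; rewrite ?mul1r // fcoord0 // !mul0r.
Qed.

Lemma opmxM i j k (S : 'Hom(V j, V k)) (T : 'Hom(V i, V j)) :
  opmx S *m opmx T = opmx (S \o T)%VF.
Proof.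
apply/matrixP => u v; rewrite !mxE comp_lfunE {1}(fcoord_sum (T _)) linear_sum fcoord_sumr.
by apply: eq_bigr => p _; rewrite !mxE linearZ /= fcoordZ mulrC.
Qed.

Lemma opmxM0 i j j' k (S : 'Hom(V j', V k)) (T : 'Hom(V i, V j)) : j != j' ->
  opmx S *m opmx T = 0.
Proof.
move=> jj'; apply/matrixP => u v; rewrite !mxE big1 // => p _; rewrite !mxE.
have [pj|pj] := eqVneq (fgr p) j; last by rewrite [X in _ * X]fcoord0 ?mulr0.
by rewrite fvec0 ?pj // linear0 /fcoord linear0r mulr0 mul0r.
Qed.

Definition blockmx (g : forall j, 'End(V j)) : 'M[K]_N := \sum_j opmx (g j).

Lemma blockmx_opl (g : forall j, 'End(V j)) i j (T : 'Hom(V i, V j)) :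
  blockmx g *m opmx T = opmx (g j \o T)%VF.
Proof.
rewrite mulmx_suml (bigD1 j) //= opmxM big1 ?addr0 // => k kj.
by rewrite opmxM0 // eq_sym.
Qed.

Lemma blockmx_opr (g : forall j, 'End(V j)) i j (T : 'Hom(V i, V j)) :
  opmx T *m blockmx g = opmx (T \o g i)%VF.
Proof. by rewrite mulmx_sumr (bigD1 i) //= opmxM big1 ?addr0 // => k ki; rewrite opmxM0. Qed.

Lemma blockmxM (g h : forall j, 'End(V j)) :
  blockmx g *m blockmx h = blockmx (fun j => g j \o h j)%VF.
Proof. by rewrite [blockmx h]/blockmx mulmx_sumr; apply: eq_bigr => j _; rewrite blockmx_opl. Qed.

Lemma blockmx1 : blockmx (fun j => \1%VF) = 1%:M.
Proof.
apply/matrixP => u v; rewrite summxE (bigD1 (fgr v)) //= big1 ?addr0 => [|j jv].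
  rewrite !mxE id_lfunE fcoord_vec; case: (eqVneq u v) => [->|_]; rewrite ?eqxx ?andbF //.
by rewrite mxE id_lfunE fvec0 1?eq_sym // /fcoord linear0r mulr0.
Qed.

Definition proj_block j : 'M[K]_N := opmx (\1%VF : 'End(V j)).

Lemma proj_blockE j u v : proj_block j u v = ((fgr u == j) && (u == v))%:R.
Proof. by rewrite mxE id_lfunE fcoord_vec. Qed.

Lemma blockmx_proj (g : forall j, 'End(V j)) j :
  blockmx g *m proj_block j = proj_block j *m blockmx g.
Proof. by rewrite blockmx_opl blockmx_opr comp_lfun1l comp_lfun1r. Qed.

Definition elementary_fun i j u w (x : V i) : V j := fcoord u x *: fvec j w.

Lemma elementary_fun_lin i j u w : linear (@elementary_fun i j u w).
Proof. by move=> a x y; rewrite /elementary_fun fcoordD fcoordZ scalerDl scalerA. Qed.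

Lemma scalar_formmx i j (lf : 'Hom(V i, V j) -> K) : scalar lf ->
  exists c : 'I_N -> 'I_N -> K, forall T, lf T = \sum_u \sum_w c u w * formmx T u w.
Proof.
move=> lin; pose E u w : 'Hom(V i, V j) := lfun_of (@elementary_fun_lin i j u w).
(* The coordinate of index [fsg w] is [fep w] times the pairing with [fvec j w]; the sign
   [(-1) ^+ d j] puts that vector in the second argument, as in [formmx]. *)
exists (fun u w => (-1) ^+ d j * fep w * lf (E u (fsg w))) => T.
pose L : {scalar 'Hom(V i, V j)} := HB.pack lf (GRing.isLinear.Build _ _ _ _ lf lin).
have TE : T = \sum_u \sum_w fcoord w (T (fvec i u)) *: E u w.
  apply/lfunP => x; rewrite sum_lfunE {1}(fcoord_sum x) linear_sum; apply: eq_bigr => u _.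
  rewrite linearZ /= {1}(fcoord_sum (T _)) scaler_sumr sum_lfunE; apply: eq_bigr => w _.
  by rewrite scale_lfunE lfun_ofE /elementary_fun !scalerA mulrC.
rewrite -[lf]/(L : _ -> K) [in LHS]TE linear_sum; apply: eq_bigr => u _; rewrite linear_sum.
rewrite (reindex_inj (inv_inj fsgK)); apply: eq_bigr => w _.
by rewrite linearZ /fcoord fsgK formC [formmx T u w]mxE /=; ring.
Qed.

(** * Operators on the blocks defined by an isometry matrix *)

Section Isometry.
Variable h : 'M[K]_N.
Hypothesis h_isom : h^T *m gram *m h = gram.
Hypothesis h_block : forall p q, fgr p != fgr q -> h p q = 0.

Definition frame_fun j (x : V j) : V j := \sum_q (\sum_p h q p * fcoord p x) *: fvec j q.

Lemma frame_fun_lin j : linear (@frame_fun j).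
Proof.
move=> a x y; rewrite /frame_fun scaler_sumr -big_split; apply: eq_bigr => q _ /=.
rewrite scalerA -scalerDl mulr_sumr -big_split; congr (_ *: _); apply: eq_bigr => p _ /=.
by rewrite fcoordD fcoordZ; ring.
Qed.

Definition frame_lfun j : 'End(V j) := lfun_of (@frame_fun_lin j).

Lemma frame_lfun_vec j u : frame_lfun j (fvec j u) = \sum_q h q u *: fvec j q.
Proof.
rewrite lfun_ofE; apply: eq_bigr => q _.
have [uj|uj] := eqVneq (fgr u) j.
  congr (_ *: _); rewrite (bigD1 u) //= fcoord_vec uj !eqxx mulr1 big1 ?addr0 // => p pu.
  by rewrite fcoord_vec (negPf pu) andbF mulr0.
have [qj|qj] := eqVneq (fgr q) j; last by rewrite (fvec0 qj) !scaler0.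
rewrite [h q u]h_block ?qj 1?eq_sym // big1 ?scale0r // => p _.
by rewrite (fvec0 uj) /fcoord linear0r !mulr0.
Qed.

Lemma frame_lfun_isom j x y : f j (frame_lfun j x) (frame_lfun j y) = f j x y.
Proof.
have vecs u v : f j (frame_lfun j (fvec j u)) (frame_lfun j (fvec j v)) = f j (fvec j u) (fvec j v).
  have [uj|uj] := eqVneq (fgr u) j; last by rewrite (fvec0 uj) linear0 !linear0l.
  rewrite !frame_lfun_vec fvec_gram uj eqxx mul1r -h_isom mxE form_sumr; apply: eq_bigr => q _.
  rewrite formZ formC form_sumr mulrC mulr_sumr mxE; congr (_ * _); apply: eq_bigr => p _.
  rewrite formZ mulrCA -formC fvec_gram [h^T _ _]mxE.
  by have [_|pj] := eqVneq (fgr p) j; rewrite ?mul1r // h_block ?mul0r // uj.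
have expand z : frame_lfun j z = \sum_u fcoord u z *: frame_lfun j (fvec j u).
  by rewrite {1}(fcoord_sum z) linear_sum; apply: eq_bigr => u _; rewrite linearZ.
rewrite (expand x) (expand y) form_sumr (form_expand x) exchange_big; apply: eq_bigr => v _ /=.
rewrite formZ formC form_sumr !mulr_sumr; apply: eq_bigr => u _.
by rewrite formZ -vecs (formC _ (frame_lfun j (fvec j u))); ring.
Qed.

Lemma form_nondeg j (x : V j) : (forall y, f j x y = 0) -> x = 0.
Proof.
move=> x0; rewrite (fcoord_sum x) big1 // => u _.
by rewrite /fcoord formC x0 !mulr0 scale0r.
Qed.

Lemma frame_lfun_ker j : lker (frame_lfun j) == 0%VS.
Proof.
apply/lker0P => x y E; apply/eqP; rewrite -subr_eq0; apply/eqP/form_nondeg => z.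
by rewrite -frame_lfun_isom linearB /= E subrr linear0l.
Qed.

Lemma frame_lfun_adj j x y : f j ((frame_lfun j)^-1%VF x) y = f j x (frame_lfun j y).
Proof. by rewrite -frame_lfun_isom -[X in f j X _]comp_lfunE lker0_compfV ?frame_lfun_ker //
  id_lfunE. Qed.

Lemma frame_lfunV_ker j : lker (frame_lfun j)^-1%VF == 0%VS.
Proof.
apply/lker0P; apply: (can_inj (g := frame_lfun j)) => x.
by rewrite -comp_lfunE lker0_compfV ?frame_lfun_ker // id_lfunE.
Qed.

Lemma frame_lfunVV j : ((frame_lfun j)^-1^-1)%VF = frame_lfun j.
Proof.
by apply: inv_lfunE; [exact: frame_lfunV_ker | rewrite lker0_compVf ?frame_lfun_ker].
Qed.

(** The inverse of an isometry is its adjoint, so moving it to the other argument of the form turns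
    conjugation into congruence. *)
Lemma formmx_isom i j (T : 'Hom(V i, V j)) :
  formmx ((frame_lfun j)^-1 \o T \o frame_lfun i)%VF = h^T *m formmx T *m h.
Proof.
apply/matrixP => u v; rewrite [LHS]mxE !comp_lfunE frame_lfun_adj !frame_lfun_vec.
rewrite [RHS]mxE form_sumr; apply: eq_bigr => q _.
have -> : T (\sum_p h p u *: fvec i p) = \sum_p h p u *: T (fvec i p).
  by rewrite linear_sum; apply: eq_bigr => p _; rewrite linearZ.
rewrite formZ mulrC [X in _ = X * _]mxE (formC (f j)) form_sumr mulr_sumr; congr (_ * _).
by apply: eq_bigr => p _; rewrite formZ mulrCA -formC !mxE.
Qed.

End Isometry.

End Frame.

From mathcomp Require Import all_classical reals complex.
Local Open Scope complex_scope.

(** * Closed immersions of quotients *)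

Section ClosedImmersion.
Variables (K : closedFieldType) (X Y : affVar K) (G H : Type).
Variables (aX : G -> X -> X) (aY : H -> Y -> Y) (f : mor X Y).
Hypothesis f_orbit : forall g x, exists h, f (aX g x) = aY h (f x).
Variable t : mor (quotVar aY) (quotVar aY).
Hypothesis quot_fix : forall c, t (quot_mor f_orbit c) = quot_mor f_orbit c.
Hypothesis pullback_surj : forall u, exists w, inv_pullback f_orbit w = u.

Local Notation pullback := (inv_pullback f_orbit).
Local Notation fY := (fixVar t).

Definition kernel_fun : set (fY -> K) :=
  [set F | exists2 w, pullback w = 0 & F = fun c : fY => quot_ev (sval c) w].

Definition kernel_zeros : set fY := [set c | forall F, kernel_fun F -> F c = 0].

Lemma kernel_zerosP (z : {c : fY | kernel_zeros c}) u v :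
  pullback u = pullback v -> quot_ev (sval (sval z)) u = quot_ev (sval (sval z)) v.
Proof.
move=> uv; apply/eqP; rewrite -subr_eq0 -rmorphB; apply/eqP.
have := svalP z; rewrite /kernel_zeros /= => /(_ (fun c : fY => quot_ev (sval c) (u - v))).
by apply; exists (u - v) => //; rewrite rmorphB /= uv subrr.
Qed.

Definition lift_inv u := sval (cid (pullback_surj u)).

Lemma lift_invK u : pullback (lift_inv u) = u.
Proof. by rewrite /lift_inv; case: cid. Qed.

(** Evaluation at a chosen preimage; by [kernel_zerosP] the choice does not matter, which makes it a
    character of the invariants of [X]. *)
Definition extend_ev (z : subVar kernel_zeros) (u : invRing aX) : K :=
  quot_ev (sval (sval z)) (lift_inv u).

Lemma extend_ev_zmod z : zmod_morphism (extend_ev z).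
Proof.
move=> u v; rewrite /extend_ev -rmorphB; apply: kernel_zerosP.
by rewrite rmorphB /= !lift_invK.
Qed.

Lemma extend_ev_monoid z : monoid_morphism (extend_ev z).
Proof.
split=> [|u v]; rewrite /extend_ev; last first.
  by rewrite -rmorphM; apply: kernel_zerosP; rewrite rmorphM /= !lift_invK.
rewrite -[RHS](rmorph1 (quot_ev (sval (sval z)))); apply: kernel_zerosP.
by rewrite lift_invK rmorph1.
Qed.

HB.instance Definition _ z := GRing.isZmodMorphism.Build _ _ _ (extend_ev_zmod z).
HB.instance Definition _ z := GRing.isMonoidMorphism.Build _ _ _ (extend_ev_monoid z).

Lemma extend_evC z a : extend_ev z (inv_cst aX a) = a.
Proof.
rewrite -[RHS](quot_evC (sval (sval z))); apply: kernel_zerosP; rewrite lift_invK.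
exact/val_inj.
Qed.

Definition extend_pt (z : subVar kernel_zeros) : quotVar aX := QuotPt (extend_evC z).

Lemma extend_pt_reg F : reg (quotVar aX) F -> reg (subVar kernel_zeros) (F \o extend_pt).
Proof.
case=> u ->; exists (fun c : fY => quot_ev (sval c) (lift_inv u)) => //.
by exists (fun c : quotVar aY => quot_ev c (lift_inv u)) => //; exists (lift_inv u).
Qed.

Definition fixed_mor : mor (quotVar aX) fY := lift_mor quot_fix.

Lemma lift_kernel_zeros c : kernel_zeros (fixed_mor c).
Proof.
move=> _ [w w0 ->] /=; rewrite -/(pullback w) w0; exact: (rmorph0 (quot_ev c)).
Qed.

(** When the pullback is surjective, characters of the invariants of [X] are the same as characters
    of those of [Y] that vanish on its kernel. *)
Lemma surjective_closed_immersion : closed_immersion fixed_mor.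
Proof.
exists kernel_zeros.
  exists kernel_fun => // _ [w _ ->].
  by exists (fun c : quotVar aY => quot_ev c w) => //; exists w.
exists (lift_mor lift_kernel_zeros) => //.
exists (Mor extend_pt_reg); split=> [c|z].
  by apply: quotPt_eq => u; rewrite /= /extend_ev /= lift_invK.
apply/sval_inj/sval_inj/quotPt_eq => u /=.
by apply: kernel_zerosP; rewrite lift_invK.
Qed.

End ClosedImmersion.

(** * Framed representations *)

Section UnitForm.
Variable K : numClosedFieldType.

Definition unit_form (x y : K^o) : K := x * y.

Lemma unit_form_bilinear : bilinear_for *%R (idfun \; *%R) unit_form.
Proof.
split=> z a x y; rewrite /unit_form /=; first by rewrite mulrDl -mulrA.
by rewrite mulrDr mulrCA.
Qed.

Lemma unit_form_sym x y : unit_form x y = (-1) ^+ false * idfun (unit_form y x).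
Proof. by rewrite mul1r; exact: mulrC. Qed.

HB.instance Definition _ := bilinear_isBilinear.Build K K^o K^o K _ _ unit_form unit_form_bilinear.
HB.instance Definition _ := isHermitianSesquilinear.Build K K^o false idfun unit_form unit_form_sym.

Definition unit_hermitian : {hermitian K^o for false & idfun} := unit_form.

Lemma unit_gram (p q : unit) : unit_hermitian (1 : K^o) (1 : K^o) = 1 * (q == p)%:R.
Proof. by case: p q => -[]; rewrite eqxx. Qed.

Definition unit_darboux : darboux unit_hermitian :=
  @Darboux K K^o false unit_hermitian unit (fun=> 1) id (fun=> 1) (fun=> erefl)
    (fun=> mulr1 1) (fun=> esym (mulr1 1)) (fun _ _ => erefl) unit_gram.

Lemma unit_darboux_basis x : x = dproj unit_darboux x.
Proof.
rewrite /dproj (bigD1 (tt : unit_darboux)) //= big1 => [|[] //].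
by rewrite addr0 /dcoord /= mul1r /unit_form mul1r /GRing.scale /= mulr1.
Qed.

End UnitForm.

Section Link.
Variables (K : numClosedFieldType) (Gm : graph) (eps : edge_sign K Gm).
Variables (V W : vertex Gm -> vectType K) (dV dW : vertex Gm -> bool).
Variable fV : forall k, {hermitian (V k) for dV k & idfun}.
Variable fW : forall k, {hermitian (W k) for dW k & idfun}.
Hypothesis ndV : forall k, nondegenerate (fV k).
Hypothesis ndW : forall k, nondegenerate (fW k).

(* The framing is encoded by one more vertex [None], carrying the line [K^o] with trivial
   group action. *)
Local Notation J := (option (vertex Gm)).
Implicit Types (i j : J) (k l : vertex Gm).

Definition xV j : vectType K := if j is Some k then V k else (K^o : vectType K).

Definition xdV j := if j is Some k then dV k else false.

Definition xfV j : {hermitian (xV j) for xdV j & idfun} :=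
  match j with Some k => fV k | None => unit_hermitian K end.

Definition xB j : darboux (xfV j) :=
  match j with
  | Some k => sval (cid (darboux_basis (ndV k)))
  | None => unit_darboux K
  end.

Lemma xB_basis j x : x = dproj (xB j) x.
Proof. by case: j x => [k|] /=; [case: cid | exact: unit_darboux_basis]. Qed.

Definition wB k : darboux (fW k) := sval (cid (darboux_basis (ndW k))).

Lemma wB_basis k x : x = dproj (wB k) x.
Proof. by rewrite /wB; case: cid. Qed.

Local Notation rep := (rep V W).
Local Notation GLv := (GLv V).
Local Notation N := #|frame_index xB|.
Local Notation gr := (@fgr K J xV xdV xfV xB).
Local Notation sg := (@fsg K J xV xdV xfV xB).
Local Notation ep := (@fep K J xV xdV xfV xB).

Definition star : 'I_N := enum_rank (Tagged (fun j => xB j) (tt : xB None)).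

Lemma gr_starE : gr star = None.
Proof. by rewrite /fgr /star enum_rankK. Qed.

Lemma gr_star u : gr u = gr star -> u = star.
Proof. by rewrite gr_starE => /frame_indexP[[] ->]. Qed.

Definition xG (g : GLv) j : 'End(xV j) :=
  match j with Some k => sval g k | None => \1%VF end.

Lemma xG_ker g j : lker (xG g j) == 0%VS.
Proof.
case: j => [k|] /=; first exact: svalP g k.
by apply/lker0P => x y; rewrite !id_lfunE.
Qed.

(** Equivariance is asked under all of [GLv] and on all representations, so that traces of such
    operators are invariant before any restriction to the fixed locus. *)
Definition equivariant_lfun i j (T : rep -> 'Hom(xV i, xV j)) : Prop :=
  (forall g x, T (rep_act g x) = (xG g j \o T x \o (xG g i)^-1)%VF) /\
  (forall lf : 'Hom(xV i, xV j) -> K, scalar lf -> poly_rep (fun x => lf (T x))).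

Lemma xG_None g : ((xG g None)^-1 = \1)%VF.
Proof. by apply: inv_lfunE; [exact: xG_ker | rewrite comp_lfun1l]. Qed.

Definition vec_fun (U : vectType K) (w : U) (a : K^o) : U := a *: w.

Lemma vec_fun_lin (U : vectType K) (w : U) : linear (vec_fun w).
Proof. by move=> a x y; rewrite /vec_fun scalerDl scalerA. Qed.

Definition vec_lfun (U : vectType K) (w : U) : 'Hom(K^o, U) := lfun_of (vec_fun_lin w).

Lemma vec_lfunE (U : vectType K) (w : U) a : vec_lfun w a = a *: w.
Proof. exact: lfun_ofE. Qed.

Definition form_fun k (w : W k) (z : W k) : K^o := fW k z w.

Lemma form_fun_lin k (w : W k) : linear (form_fun w).
Proof. by move=> a x y; exact: formPl. Qed.

Definition form_lfun k (w : W k) : 'Hom(W k, K^o) := lfun_of (form_fun_lin w).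

Lemma form_lfunE k (w z : W k) : form_lfun w z = fW k z w.
Proof. exact: lfun_ofE. Qed.

Definition arrow_op k l (h : edge k l) (x : rep) : 'Hom(xV (Some k), xV (Some l)) := rx x h.

Definition in_op k (w : W k) (x : rep) : 'Hom(xV None, xV (Some k)) := (rp x k \o vec_lfun w)%VF.

Definition out_op k (w : W k) (x : rep) : 'Hom(xV (Some k), xV None) := (form_lfun w \o rq x k)%VF.

(** A constant letter, used to bring words to a common length. *)
Definition one_op (x : rep) : 'Hom(xV None, xV None) := \1%VF.

Lemma arrow_op_equivariant k l (h : edge k l) : equivariant_lfun (arrow_op h).
Proof. by split=> // lf lin; exact: poly_x. Qed.

Lemma in_op_equivariant k (w : W k) : equivariant_lfun (in_op w).
Proof.
split=> [g x|lf lin]; first by rewrite xG_None comp_lfun1r /in_op /= comp_lfunA.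
apply: (poly_p (l := fun P => lf (P \o vec_lfun w)%VF)) => a P Q.
by rewrite comp_lfunDl -comp_lfunZl lin.
Qed.

Lemma out_op_equivariant k (w : W k) : equivariant_lfun (out_op w).
Proof.
split=> [g x|lf lin]; first by rewrite comp_lfun1l /out_op /= comp_lfunA.
apply: (poly_q (l := fun P => lf (form_lfun w \o P)%VF)) => a P Q.
by rewrite comp_lfunDr -comp_lfunZr lin.
Qed.

Lemma one_op_equivariant : equivariant_lfun one_op.
Proof.
split=> [g x|lf lin]; last exact: (@poly_cst K Gm V W (lf \1%VF)).
by rewrite xG_None /one_op /= !comp_lfun1l.
Qed.

Local Notation LT := (LambdaTau eps ndV ndW).
Local Notation gram := (gram sg ep).
Local Notation formmx := (@formmx K J xV xdV xfV xB _ _).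
Local Notation opmx := (@opmx K J xV xdV xfV xB _ _).
Local Notation frame_lfun := (@frame_lfun K J xV xdV xfV xB).
Local Notation gauge := (gauge gr sg ep star).

Definition rep_of (x : LT) : rep := sval (sval x).

Lemma rep_of_inj x y : rep_of x = rep_of y -> x = y.
Proof. by move=> xy; apply/sval_inj/sval_inj. Qed.

(** * Isometry matrices as elements of the group fixed by [tau] *)

Section GaugeAction.
Variable h : 'M[K]_N.
Hypothesis gh : gauge h.

Let h_isom : h^T *m gram *m h = gram. Proof. by case: gh. Qed.
Let h_block p q : gr p != gr q -> h p q = 0. Proof. by by case: gh => _ + _; apply. Qed.

(** The inverse is taken so that the action on representations becomes the congruence by [h] of
    [formmx_isom]. *)
Definition gauge_GL : GLv :=
  exist (fun g : forall k, 'End(V k) => forall k, lker (g k) == 0%VS) (fun k => (frame_lfun h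
    (Some k))^-1%VF)
    (fun k => frame_lfunV_ker xB_basis h_isom h_block (Some k)).

Lemma gauge_tau k :
  (sval gauge_GL k \o adjoint (fV k) (fV k) (sval gauge_GL k) = \1)%VF.
Proof.
have -> : adjoint (fV k) (fV k) (sval gauge_GL k) = frame_lfun h (Some k).
  apply: (adjoint_uniq (ndV k)) => x y.
  exact: (frame_lfun_adj xB_basis h_isom h_block (j := Some k)).
by rewrite /= lker0_compVf // (frame_lfun_ker xB_basis h_isom h_block (Some k)).
Qed.

Definition gauge_GLtau : GLv_tau fV := exist _ gauge_GL gauge_tau.

Lemma frame_lfun_None : frame_lfun h None = \1%VF.
Proof.
apply: (lfun_frame_eq xB_basis) => u; rewrite frame_lfun_vec // id_lfunE.
have [->|us] := eqVneq u star; last first.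
  have nu : gr u != None by apply: contra us => /eqP gu; apply/eqP/gr_star; rewrite gr_starE.
  rewrite fvec0 // big1 // => q _.
  have [q0|q0] := eqVneq (gr q) None; last by rewrite fvec0 // scaler0.
  by rewrite h_block ?scale0r // q0 eq_sym.
rewrite (bigD1 star) //= big1 ?addr0 => [|q qs]; first by case: gh => _ _ ->; rewrite scale1r.
rewrite fvec0 ?scaler0 //; apply: contra qs => /eqP gq; apply/eqP/gr_star.
by rewrite gr_starE.
Qed.

Lemma xG_gauge j : xG gauge_GL j = (frame_lfun h j)^-1%VF.
Proof.
case: j => [k|] //=; rewrite frame_lfun_None; apply/esym/inv_lfunE.
  by apply/lker0P => x y; rewrite !id_lfunE.
exact: comp_lfun1l.
Qed.

Lemma formmx_gauge i j (T : rep -> 'Hom(xV i, xV j)) x : equivariant_lfun T ->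
  formmx (T (rep_act gauge_GL x)) = h^T *m formmx (T x) *m h.
Proof.
case=> equiT _; rewrite equiT !xG_gauge (frame_lfunVV xB_basis h_isom h_block).
exact: (formmx_isom xB_basis h_isom h_block).
Qed.

End GaugeAction.

Definition letters : finType :=
  ({k : vertex Gm & {l : vertex Gm & edge k l}} + ({k & wB k} + {k & wB k}) + unit)%type.

Definition letter_mx (a : letters) (x : LT) : 'M[K]_N :=
  match a with
  | inl (inl (existT k (existT l h))) => formmx (arrow_op h (rep_of x))
  | inl (inr (inl (existT k c))) => formmx (in_op (dvec c) (rep_of x))
  | inl (inr (inr (existT k c))) => formmx (out_op (dvec c) (rep_of x))
  | inr _ => formmx (one_op (rep_of x))
  end.

Lemma letter_mx_gauge h x : gauge h ->
  exists y, forall a, letter_mx a y = h^T *m letter_mx a x *m h.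
Proof.
move=> gh; exists (LambdaTau_act (gauge_GLtau gh) x) => -[[[k [l e]]|[[k c]|[k c]]]|[]] /=;
  apply: (formmx_gauge gh).
- exact: arrow_op_equivariant.
- exact: in_op_equivariant.
- exact: out_op_equivariant.
- exact: one_op_equivariant.
Qed.

(** Expansion in the bases of the [W k] recovers [p] and [q] from their letters. Hence a point whose
    letters are congruent by [h] to those of [x] is the translate of [x] by [gauge_GLtau]. *)
Lemma letter_mx_inj x y : (forall a, letter_mx a x = letter_mx a y) -> x = y.
Proof.
have inj i j (S T : 'Hom(xV i, xV j)) : formmx S = formmx T -> S = T.
  move=> /matrixP E; apply: (lfun_frame_eq xB_basis) => u.
  rewrite (fcoord_sum xB_basis (S _)) (fcoord_sum xB_basis (T _)); apply: eq_bigr => v _.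
  rewrite /fcoord formC [in RHS]formC; congr (_ * (_ * _) *: _).
  by have := E u (sg v); rewrite !mxE.
move=> E; apply: rep_of_inj; apply: rep_eq => [k l h|k|k].
- exact: (inj (Some k) (Some l) _ _ (E (inl (inl (existT _ k (existT _ l h)))))).
- apply/lfunP => w; rewrite (wB_basis w) !linear_sum; apply: eq_bigr => c _; rewrite !linearZ /=;
    congr (_ *: _).
  have /lfunP/(_ (1 : K^o)) := inj None (Some k) _ _ (E (inl (inr (inl (existT _ k c))))).
  by rewrite !comp_lfunE !vec_lfunE !scale1r.
- apply/lfunP => v; rewrite (wB_basis (rq _ _ _)) [RHS]wB_basis; apply: eq_bigr => c _.
  have /lfunP/(_ v) := inj (Some k) None _ _ (E (inl (inr (inr (existT _ k (dsg c)))))).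
  rewrite !comp_lfunE !form_lfunE => Ev; rewrite /dcoord formC [in RHS]formC.
  by congr (_ * (_ * _) *: _).
Qed.

(** * Equivariant operators and extension of their traces *)

Local Notation blockmx := (@blockmx K J xV xdV xfV xB).
Local Notation proj_block := (@proj_block K J xV xdV xfV xB).

Lemma poly_rep_sum (T : finType) (P : pred T) (F : T -> rep -> K) :
  (forall t, P t -> poly_rep (F t)) -> poly_rep (fun x => \sum_(t | P t) F t x).
Proof.
move=> pF; rewrite (_ : (fun x => _) = \sum_(t | P t) F t); last first.
  by apply/funext => x; rewrite fct_sumE.
apply: (big_ind (@poly_rep K Gm V W)) => //; last exact: poly_add.
exact: (@poly_cst K Gm V W 0).
Qed.

Lemma poly_repZ a F : @poly_rep K Gm V W F -> poly_rep (fun x => a * F x).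
Proof. by move=> pF; apply: (poly_mul (f := cst a)) => //; exact: poly_cst. Qed.

Definition equivariant_mx (O : rep -> 'M[K]_N) : Prop :=
  (forall g x, O (rep_act g x) = blockmx (xG g) *m O x *m blockmx (fun j => (xG g j)^-1%VF)) /\
  (forall u v, poly_rep (fun x => O x u v)).

Lemma blockmx_xG g : blockmx (fun j => (xG g j)^-1%VF) *m blockmx (xG g) = 1%:M.
Proof.
rewrite blockmxM; last exact: xB_basis.
rewrite -(blockmx1 xB); congr blockmx; apply: functional_extensionality_dep => j.
by rewrite lker0_compVf // xG_ker.
Qed.

Lemma opmx_equivariant i j (T : rep -> 'Hom(xV i, xV j)) :
  equivariant_lfun T -> equivariant_mx (fun x => opmx (T x)).
Proof.
case=> equiT polT; split=> [g x|u v].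
  by rewrite equiT blockmx_opl ?blockmx_opr //; exact: xB_basis.
have lin : scalar (fun S : 'Hom(xV i, xV j) => fcoord u (S (@fvec _ _ _ _ _ xB i v)) : K).
  by move=> a S S'; rewrite add_lfunE scale_lfunE fcoord_lin.
have := polT _ lin; congr poly_rep; apply/funext => x.
by rewrite mxE.
Qed.

Lemma blockmx_xG_proj g i :
  blockmx (fun j => (xG g j)^-1%VF) *m proj_block i *m blockmx (xG g) = proj_block i.
Proof. by rewrite (blockmx_proj xB_basis) -mulmxA blockmx_xG mulmx1. Qed.

Lemma mulmx_proj i (M M' : 'M[K]_N) u v :
  (M *m proj_block i *m M') u v = \sum_(q | gr q == i) M u q * M' q v.
Proof.
rewrite mxE [RHS]big_mkcond; apply: eq_bigr => q _.
rewrite mxE (bigD1 q) //= proj_blockE eqxx andbT big1 ?addr0.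
  by case: eqP => _; rewrite ?mulr1 ?mulr0 ?mul0r.
by move=> p pq; rewrite proj_blockE (negPf pq) andbF mulr0.
Qed.

(** The block projector commutes with the group, so the inner group factors cancel. *)
Lemma equivariant_mx_mul i O O' : equivariant_mx O -> equivariant_mx O' ->
  equivariant_mx (fun x => O x *m proj_block i *m O' x).
Proof.
move=> [eO pO] [eO' pO']; split=> [g x|u v].
  rewrite eO eO' -[X in _ = _ *m (_ *m X *m _) *m _](blockmx_xG_proj g).
  by rewrite !mulmxA.
rewrite (_ : (fun x => _) = fun x => \sum_(q | gr q == i) O x u q * O' x q v).
  by apply: poly_rep_sum => q _; exact: poly_mul.
by apply/funext => x; rewrite mulmx_proj.
Qed.

Lemma equivariant_mxZ a O : equivariant_mx O -> equivariant_mx (fun x => a *: O x).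
Proof.
move=> [eO pO]; split=> [g x|u v]; first by rewrite eO -scalemxAr -scalemxAl.
rewrite (_ : (fun x => _) = fun x => a * O x u v); first exact: poly_repZ.
by apply/funext => x; rewrite mxE.
Qed.

(** Both the form and its flip come from equivariant operators defined on all representations; the
    second operator keeps the class stable under [flip]. *)
Definition good (Z : LT -> 'I_N -> 'I_N -> K) : Prop :=
  exists O O', [/\ equivariant_mx O, equivariant_mx O',
    forall x u v, Z x u v = ((O (rep_of x))^T *m gram) u v &
    forall x u v, Z x v u = ((O' (rep_of x))^T *m gram) u v].

Local Notation sgn_at i := ((-1) ^+ xdV i : K).

Lemma mulmx_gram (M : 'M[K]_N) u v : (M^T *m gram) u v = M (sg v) u * ep (sg v).
Proof.
have sK := @fsgK K J xV xdV xfV xB.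
rewrite mxE (bigD1 (sg v)) //= !mxE sK eqxx mulr1 big1 ?addr0 // => q qv.
by rewrite [gram _ _]mxE eq_sym (can2_eq sK sK) (negPf qv) !mulr0.
Qed.

(** Contraction of forms is composition of the underlying operators in the opposite order, through
    block [i]. *)
Lemma form_comp_mx i (M M' : 'M[K]_N) u v :
  \sum_(p | gr p == i) ep p * ((M^T *m gram) u p * (M'^T *m gram) (sg p) v) =
  ((sgn_at i *: (M' *m proj_block i *m M))^T *m gram) u v.
Proof.
have sK := @fsgK K J xV xdV xfV xB.
rewrite mulmx_gram mxE mulmx_proj mulr_sumr mulr_suml.
rewrite [RHS](reindex_inj (inv_inj sK)); apply: eq_big => [p|p /eqP gp]; first by rewrite fgr_sg.
rewrite !mulmx_gram fep_sg gp.
transitivity (sgn_at i * (ep p * ep p) * (M' (sg v) (sg p) * M (sg p) u) * ep (sg v));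
  first by ring.
by rewrite fep2 mulr1.
Qed.

Lemma form_comp_flip i (Z Z' : LT -> 'I_N -> 'I_N -> K) x u v :
  form_comp gr sg ep i Z Z' x v u = sgn_at i * form_comp gr sg ep i (flip Z') (flip Z) x u v.
Proof.
rewrite /form_comp mulr_sumr (reindex_inj (inv_inj (@fsgK K J xV xdV xfV xB))).
apply: eq_big => [p|p]; rewrite fgr_sg // => /eqP gp.
by rewrite /flip fsgK fep_sg gp; ring.
Qed.

Lemma good_flip Z : good Z -> good (flip Z).
Proof. by case=> O [O' [eO eO' ZO ZO']]; exists O', O. Qed.

Lemma good_comp i Z Z' : good Z -> good Z' -> good (form_comp gr sg ep i Z Z').
Proof.
move=> [O1 [O1' [eO1 eO1' ZO1 ZO1']]] [O2 [O2' [eO2 eO2' ZO2 ZO2']]].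
exists (fun x => sgn_at i *: (O2 x *m proj_block i *m O1 x)).
(* One sign comes from [form_comp_flip], the other from [form_comp_mx]. *)
exists (fun x => sgn_at i *: (sgn_at i *: (O1' x *m proj_block i *m O2' x))); split.
- exact/equivariant_mxZ/equivariant_mx_mul.
- exact/equivariant_mxZ/equivariant_mxZ/equivariant_mx_mul.
- move=> x u v; rewrite -form_comp_mx; apply: eq_bigr => p _.
  by rewrite ZO1 ZO2.
- move=> x u v; rewrite form_comp_flip [_^T]linearZ /= -scalemxAl [RHS]mxE; congr (_ * _).
  by rewrite -form_comp_mx; apply: eq_bigr => p _; rewrite /flip ZO1' ZO2'.
Qed.

Definition restricted (r : LT -> K) : Prop :=
  exists w : invRing (@Lambda_act K Gm V W eps), forall x, r x = inv_fun w (sval x).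

(** The form trace is the operator trace over block [i], which is invariant under conjugation on all
    of Lambda. *)
Lemma good_trace i Z : good Z -> restricted (form_trace gr sg ep i Z).
Proof.
case=> O [_ [[eO pO] _ ZO _]].
pose F (x : LambdaVar V W eps) := \sum_(q | gr q == i) O (sval x) q q.
have FI : F \in invariant_fun (@Lambda_act K Gm V W eps).
  apply/invariantP; split.
    by exists (fun x => \sum_(q | gr q == i) O x q q) => //; apply: poly_rep_sum.
  have FE x : F x = \tr (proj_block i *m O (sval x)).
    rewrite /F big_mkcond; apply: eq_bigr => q _.
    rewrite mxE (bigD1 q) //= proj_blockE eqxx andbT big1 ?addr0.
      by case: eqP => _; rewrite ?mul1r ?mul0r.
    by move=> p pq; rewrite proj_blockE (eq_sym q) (negPf pq) andbF mul0r.
  by move=> g x; rewrite !FE eO mulmxA mxtrace_mulC !mulmxA blockmx_xG_proj.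
exists (InvRing FI) => x; apply: eq_bigr => p /eqP gp.
rewrite ZO mulmx_gram fsgK mulrCA fep2 mulr1 //.
Qed.

Lemma restricted_cst a : restricted (fun=> a).
Proof. by exists (inv_cst _ a). Qed.

Lemma restrictedD r s : restricted r -> restricted s -> restricted (fun x => r x + s x).
Proof.
move=> [u Hu] [w Hw]; exists (InvRing (invariantD (inv_funP u) (inv_funP w))) => x.
by rewrite Hu Hw.
Qed.

Lemma restrictedM r s : restricted r -> restricted s -> restricted (fun x => r x * s x).
Proof.
move=> [u Hu] [w Hw]; exists (InvRing (invariantM (inv_funP u) (inv_funP w))) => x.
by rewrite Hu Hw.
Qed.

Lemma isometry_invariantP (F : LT -> K) :
  (forall g x, F (LambdaTau_act g x) = F x) ->
  isometry_invariant gr sg ep star letter_mx F.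
Proof.
move=> FI h x y gh Hy; rewrite -(FI (gauge_GLtau gh) x); congr F.
apply: letter_mx_inj => a; rewrite Hy; move: a => [[[k [l e]]|[[k c]|[k c]]]|[]] /=;
  apply/esym/(formmx_gauge gh).
- exact: arrow_op_equivariant.
- exact: in_op_equivariant.
- exact: out_op_equivariant.
- exact: one_op_equivariant.
Qed.

Lemma restricted_invariant r : restricted r -> isometry_invariant gr sg ep star letter_mx r.
Proof.
case=> w rw; apply: isometry_invariantP => g x; rewrite !rw.
by have /invariantP[_ ->] := inv_funP w.
Qed.

(* A letter and its transpose are both given by equivariant operators on the fixed locus:
   the transpose of [x_h] is [+-x_(erev h)], and [p], [q] are transposes of each other. *)
Lemma good_formmx i j (T : rep -> 'Hom(xV i, xV j)) (T' : rep -> 'Hom(xV j, xV i)) c :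
  equivariant_lfun T -> equivariant_lfun T' ->
  (forall (x : LT) a b, xfV j (T (rep_of x) a) b = c * xfV i (T' (rep_of x) b) a) ->
  good (fun x => formmx (T (rep_of x))).
Proof.
move=> eT eT' TT'; exists (fun x => opmx (T x)), (fun x => c *: opmx (T' x)); split.
- exact: opmx_equivariant.
- exact/equivariant_mxZ/opmx_equivariant.
- by move=> x u v; rewrite formmx_op //; exact: xB_basis.
- move=> x u v; rewrite [_^T]linearZ /= -scalemxAl -(formmx_op xB_basis) !mxE; exact: TT'.
Qed.

Lemma tau_rep_of (x : LT) : tau_rep eps fV fW (rep_of x) = rep_of x.
Proof. by have /(congr1 sval) := svalP x. Qed.

Lemma good_letter a : good (letter_mx a).
Proof.
case: a => [[[k [l e]]|[[k w]|[k w]]]|[]] /=.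
(* On the fixed locus the operator at [erev e] is [sgn eps (erev e)] times the adjoint of the one at
   [e]; the other sign exchanges the arguments of the form on [V k]. *)
- apply: (good_formmx (T' := arrow_op (erev e)) (c := (-1) ^+ dV k * sgn eps (erev e))).
  + exact: arrow_op_equivariant.
  + exact: arrow_op_equivariant.
  + move=> x a b /=; rewrite (adjointP (fV l) (ndV k)) formC -mulrA; congr (_ * _).
    rewrite /arrow_op -[X in rx X (erev e)]tau_rep_of /= erevK scale_lfunE linearZl_LR mulrA.
    by case: (sgnP eps (erev e)) => ->; rewrite ?mulrNN !mul1r.
(* On the fixed locus [q] is the adjoint of [p]; the sign is the symmetry of the form on [W k]. *)
- apply: (good_formmx (T' := out_op (dvec w)) (c := (-1) ^+ dW k)).
  + exact: in_op_equivariant.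
  + exact: out_op_equivariant.
  + move=> x a b /=; rewrite /in_op /out_op !comp_lfunE vec_lfunE form_lfunE.
    rewrite -[X in rq X k]tau_rep_of /= linearZ /= formZl (adjointP (fV k) (ndW k)).
    by rewrite formC /unit_form; ring.
(* On the fixed locus [p] is minus the adjoint of [q], whence the extra sign. *)
- apply: (good_formmx (T' := in_op (dvec w)) (c := - (-1) ^+ dV k)).
  + exact: out_op_equivariant.
  + exact: in_op_equivariant.
  + move=> x a b /=; rewrite /in_op /out_op !comp_lfunE vec_lfunE form_lfunE.
    rewrite -[X in rp X k]tau_rep_of /= linearZ /= formZl opp_lfunE linearNl.
    by rewrite (adjointP (fW k) (ndV k)) (formC (fV k)) /unit_form; ring.
- apply: (good_formmx (T' := one_op) (c := 1)); try exact: one_op_equivariant.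
  by move=> x a b; rewrite /one_op !id_lfunE mul1r formC mul1r.
Qed.

End Link.

(** * Words span the regular functions *)

Section WordSpan.
Variables (K : numClosedFieldType) (N : nat) (X : Type) (L : finType) (Y : L -> X -> 'M[K]_N).
Variables (one : L) (star : 'I_N).
Hypothesis Y_one : forall x, Y one x star star = 1.

Definition word_span d (F : X -> K) : Prop := exists t, forall x, F x = @tensor_val K N X L Y d t x.

Lemma word_span_sum d (T : finType) (F : T -> X -> K) (a : T -> K) :
  (forall s, word_span d (F s)) -> word_span d (fun x => \sum_s a s * F s x).
Proof.
move=> /choice[t Ht]; exists (fun c => \sum_s a s * t s c) => x.
rewrite /tensor_val; under [RHS]eq_bigr do rewrite mulr_suml.
rewrite exchange_big; apply: eq_bigr => s _; rewrite Ht mulr_sumr.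
by apply: eq_bigr => c _; rewrite mulrA.
Qed.

Lemma word_spanD d F G : word_span d F -> word_span d G -> word_span d (fun x => F x + G x).
Proof.
move=> sF sG.
have := @word_span_sum d bool (fun b => if b then F else G) (fun=> 1).
move=> /(_ (fun b => if b as b' return word_span d (if b' then F else G) then sF else sG)) [t Ht].
by exists t => x; rewrite -Ht big_bool !mul1r.
Qed.

Lemma word_span_word d w e : word_span d (fun x => word Y (d := d) w x e).
Proof.
exists (fun c => (c == (w, e))%:R) => x; rewrite /tensor_val (bigD1 (w, e)) //= eqxx mul1r.
by rewrite big1 ?addr0 // => c /negPf->; rewrite mul0r.
Qed.

Lemma wordM d1 d2 w1 e1 w2 e2 : exists w e, forall x,
  @word K N X L Y d1 w1 x e1 * @word K N X L Y d2 w2 x e2 = @word K N X L Y (d1 + d2) w x e.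
Proof.
exists [ffun k : 'I_(d1 + d2) => match fintype.split k with inl i => w1 i | inr i => w2 i end].
exists [ffun a : 'I_(d1 + d2) * bool => match fintype.split a.1 with inl i => e1 (i, a.2) | inr i
  => e2 (i, a.2) end] => x.
rewrite /word big_split_ord; congr (_ * _); apply: eq_bigr => k _; rewrite !ffunE /=.
  by rewrite (unsplitK (inl k)).
by rewrite (unsplitK (inr k)).
Qed.

Lemma word_spanM d1 d2 F G : word_span d1 F -> word_span d2 G ->
  word_span (d1 + d2) (fun x => F x * G x).
Proof.
move=> [s Hs] [t Ht].
pose F1 c x := s c * @word K N X L Y d1 c.1 x c.2.
have := @word_span_sum (d1 + d2) (tensor_index N L d1 * tensor_index N L d2)%type
  (fun c x => @word K N X L Y d1 c.1.1 x c.1.2 * @word K N X L Y d2 c.2.1 x c.2.2)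
  (fun c => s c.1 * t c.2).
case=> [c|r Hr].
  have [w [e we]] := wordM c.1.1 c.1.2 c.2.1 c.2.2.
  by have [r Hr] := word_span_word w e; exists r => x; rewrite we Hr.
exists r => x; rewrite -Hr Hs Ht /tensor_val big_distrlr /= pair_bigA.
by apply: eq_bigr => -[c c'] _ /=; rewrite mulrACA.
Qed.

Lemma word_span_entry l u v : word_span 1 (fun x => Y l x u v).
Proof.
have [t Ht] := @word_span_word 1 [ffun=> l] [ffun a : 'I_1 * bool => if a.2 then v else u].
by exists t => x; rewrite -Ht /word big_ord1 !ffunE.
Qed.

Lemma word_span_cst d a : word_span d (fun=> a).
Proof.
have [t Ht] := @word_span_word d [ffun=> one] [ffun=> star].
have [|r Hr] := @word_span_sum d unit (fun=> fun=> 1) (fun=> a).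
  move=> _; exists t => x; rewrite -Ht /word big1 // => k _; rewrite !ffunE.
  exact: Y_one.
by exists r => x; rewrite -Hr big_const card_unit /= addr0 mulr1.
Qed.

Definition word_poly F := exists d, word_span d F.

Lemma word_polyM F G : word_poly F -> word_poly G -> word_poly (fun x => F x * G x).
Proof. by move=> [d1 sF] [d2 sG]; exists (d1 + d2)%N; exact: word_spanM. Qed.

(** Sums require words of one length, so both summands are padded by constants to length
    [d1 + d2]. *)
Lemma word_polyD F G : word_poly F -> word_poly G -> word_poly (fun x => F x + G x).
Proof.
move=> [d1 sF] [d2 sG]; exists (d1 + d2)%N; apply: word_spanD.
  have [t Ht] := word_spanM sF (word_span_cst d2 1).
  by exists t => x; rewrite -Ht mulr1.
have [t Ht] := word_spanM (word_span_cst d1 1) sG.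
by exists t => x; rewrite -Ht mul1r.
Qed.

Lemma word_poly_cst a : word_poly (fun=> a).
Proof. by exists 0%N; exact: word_span_cst. Qed.

Lemma word_poly_ext F G : (forall x, F x = G x) -> word_poly F -> word_poly G.
Proof. by move=> FG [d [t Ht]]; exists d, t => x; rewrite -FG. Qed.

Lemma word_poly_sum (T : finType) (F : T -> X -> K) :
  (forall s, word_poly (F s)) -> word_poly (fun x => \sum_s F s x).
Proof.
move=> pF; elim: (index_enum T) => [|s r IHr].
  by apply: word_poly_ext (word_poly_cst 0) => x; rewrite big_nil.
by apply: word_poly_ext (word_polyD (pF s) IHr) => x; rewrite big_cons.
Qed.

End WordSpan.

(** * Extension of invariant functions and the closed immersion *)

Section Surjectivity.
Variables (K : numClosedFieldType) (Gm : graph) (eps : edge_sign K Gm).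
Variables (V W : vertex Gm -> vectType K) (dV dW : vertex Gm -> bool).
Variable fV : forall k, {hermitian (V k) for dV k & idfun}.
Variable fW : forall k, {hermitian (W k) for dW k & idfun}.
Hypothesis ndV : forall k, nondegenerate (fV k).
Hypothesis ndW : forall k, nondegenerate (fW k).

Local Notation LT := (LambdaTau eps ndV ndW).
Local Notation rep_of := (@rep_of K Gm eps V W dV dW fV fW ndV ndW).
Local Notation Y := (@letter_mx K Gm eps V W dV dW fV fW ndV ndW).
Local Notation word_poly := (@word_poly K _ LT _ Y).
Local Notation xV := (xV V).
Local Notation B := (xB ndV).

Lemma one_entry x : Y (inr tt) x (star ndV) (star ndV) = 1.
Proof.
rewrite mxE id_lfunE fvec_gram gr_starE eqxx mul1r mxE fsg_id ?gr_starE // eqxx mulr1.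
by rewrite /fep /star enum_rankK.
Qed.

Lemma word_poly_scalar a i j (T : rep V W -> 'Hom(xV i, xV j)) (lf : 'Hom(xV i, xV j) -> K) :
  (forall x, Y a x = formmx B (T (rep_of x))) -> scalar lf ->
  word_poly (fun x => lf (T (rep_of x))).
Proof.
move=> YT lin; have [c Hc] := scalar_formmx (xB_basis ndV) lin.
apply: (word_poly_ext (F := fun x => \sum_u \sum_w c u w * Y a x u w)) => [x|].
  by rewrite Hc; apply: eq_bigr => u _; apply: eq_bigr => w _; rewrite YT.
do 2![apply: (word_poly_sum one_entry) => ?]; apply: word_polyM.
  exact: (word_poly_cst one_entry).
by exists 1%N; exact: word_span_entry.
Qed.

Definition coeff k (c : wB ndW k) : K := dep (dsg c) * (-1) ^+ dW k.

Lemma dcoordE k (c : wB ndW k) z : dcoord c z = coeff c * fW k z (dvec (dsg c)).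
Proof. by rewrite /dcoord formC mulrA. Qed.

Definition coord_lfun k (c : wB ndW k) : 'Hom(W k, K^o) :=
  coeff c *: form_lfun fW (dvec (dsg c)).

Lemma coord_lfunE k (c : wB ndW k) z : coord_lfun c z = dcoord c z.
Proof. by rewrite scale_lfunE form_lfunE dcoordE. Qed.

(** Linear functions of the arrows are combinations of letter entries. Those of [p] and [q] reduce
    to letters by expanding in a basis of [W k] at the source and at the target, respectively. *)
Lemma word_poly_rep F : @poly_rep K Gm V W F -> word_poly (fun x => F (rep_of x)).
Proof.
elim=> [a|k l h lf lin|k lf lin|k lf lin|f g _ IHf _ IHg|f g _ IHf _ IHg].
- exact: (word_poly_cst one_entry).
- exact: (@word_poly_scalar (inl (inl (existT _ k (existT _ l h)))) (Some k) (Some l)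
    (arrow_op h)).
- pose lc c (T : 'Hom(xV None, xV (Some k))) := lf (T \o coord_lfun c)%VF.
  pose L : {scalar 'Hom(W k, V k)} := HB.pack lf (GRing.isLinear.Build _ _ _ _ lf lin).
  apply: (word_poly_ext (F := fun x => \sum_(c : wB ndW k) lc c (in_op (V := V) (dvec c) (rep_of
    x)))).
    move=> x; rewrite /lc -[lf]/(L : _ -> K) -linear_sum; congr (L _).
    apply/lfunP => z; rewrite sum_lfunE {2}(wB_basis ndW z) linear_sum; apply: eq_bigr => c _.
    by rewrite !comp_lfunE vec_lfunE coord_lfunE.
  apply: (word_poly_sum one_entry) => c.
  apply: (@word_poly_scalar (inl (inr (inl (existT _ k c)))) None (Some k) (in_op (V := V) (dvec
    c))) => //.
  by move=> a S T; rewrite /lc comp_lfunDl -comp_lfunZl lin.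
- pose lc c (T : 'Hom(xV (Some k), xV None)) := lf (coeff c *: (vec_lfun (dvec c) \o T))%VF.
  pose L : {scalar 'Hom(V k, W k)} := HB.pack lf (GRing.isLinear.Build _ _ _ _ lf lin).
  apply: (word_poly_ext (F := fun x => \sum_(c : wB ndW k) lc c (out_op (V := V) fW (dvec (dsg
    c)) (rep_of x)))).
    move=> x; rewrite /lc -[lf]/(L : _ -> K) -linear_sum; congr (L _).
    apply/lfunP => z; rewrite sum_lfunE [RHS](wB_basis ndW); apply: eq_bigr => c _.
    by rewrite scale_lfunE !comp_lfunE vec_lfunE form_lfunE scalerA dcoordE.
  apply: (word_poly_sum one_entry) => c.
  apply: (@word_poly_scalar (inl (inr (inr (existT _ k (dsg c))))) (Some k) None
    (out_op (V := V) fW (dvec (dsg c)))) => //.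
  move=> a S T; rewrite /lc comp_lfunDr -comp_lfunZr scalerDr [_ *: (a *: _)]scalerA.
  by rewrite [_ * a]mulrC -scalerA lin.
- exact: (word_polyD one_entry).
- exact: word_polyM.
Qed.

(** A regular function on the fixed locus is the restriction of a polynomial on representations,
    hence the value of a tensor; its invariance passes to isometry matrices, and
    [isometry_invariant_val] yields the extension. *)
Lemma invariant_lift (u : invRing (@LambdaTau_act K Gm V W eps dV dW fV fW ndV ndW)) :
  exists w : invRing (@Lambda_act K Gm V W eps), forall x, inv_fun u x = inv_fun w (sval x).
Proof.
have /invariantP[[F [F' pF' ->] uF] uI] := inv_funP u.
have [d [t Ht]] : word_poly (inv_fun u).
  by apply: word_poly_ext (word_poly_rep pF') => x; rewrite uF.
have Et : inv_fun u = tensor_val Y t by apply/funext.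
have [w Hw] : restricted (inv_fun u).
  rewrite Et.
  have dl_star : ~~ xdV dV (fgr (star ndV)) by rewrite gr_starE.
  apply: (isometry_invariant_val (@fgr_sg _ _ _ _ _ B) (@fsgK _ _ _ _ _ B) (@fep2 _ _ _ _ _ B)
    (@fep_sg _ _ _ _ _ B) (@fsg_id _ _ _ _ _ B) (@gr_star _ _ _ _ _ ndV) dl_star
    (@letter_mx_gauge _ _ eps _ _ _ _ _ _ ndV ndW) (@good_letter _ _ eps _ _ _ _ _ _ ndV ndW)
    (@good_flip _ _ eps _ _ _ _ _ _ ndV ndW) (@good_comp _ _ eps _ _ _ _ _ _ ndV ndW)
    (@good_trace _ _ eps _ _ _ _ _ _ ndV ndW) (@restricted_cst _ _ eps _ _ _ _ _ _ ndV ndW)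
    (@restrictedD _ _ eps _ _ _ _ _ _ ndV ndW) (@restrictedM _ _ eps _ _ _ _ _ _ ndV ndW)
    (@restricted_invariant _ _ eps _ _ _ _ _ _ ndV ndW)).
  rewrite -Et; apply: isometry_invariantP => g x; exact: uI.
by exists w.
Qed.

Theorem iota_closed_immersion : closed_immersion (iota_tau eps ndV ndW).
Proof.
apply: (surjective_closed_immersion (f_orbit := @incl_orbit K Gm V W eps dV dW fV fW ndV ndW)
  (@iota_fix K Gm V W eps dV dW fV fW ndV ndW)) => u.
by have [w Hw] := invariant_lift u; exists w; apply/val_inj/funext => x; rewrite /= Hw.
Qed.

End Surjectivity.

Theorem proposition9p2p1 (R : realType) (Gm : graph) (eps : edge_sign R[i] Gm)
    (V W : vertex Gm -> vectType R[i]) (dV dW : vertex Gm -> bool)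
    (fV : forall k, {hermitian (V k) for dV k & idfun})
    (fW : forall k, {hermitian (W k) for dW k & idfun})
    (ndV : forall k, nondegenerate (fV k))
    (ndW : forall k, nondegenerate (fW k))
    (signVW : forall k, (-1) ^+ dV k * (-1) ^+ dW k = -1 :> R[i])
    (signV : forall k l, edge k l -> (-1) ^+ dV k * (-1) ^+ dV l = -1 :> R[i]) :
  closed_immersion (iota_tau eps ndV ndW).
Proof. exact: iota_closed_immersion. Qed.
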